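(* Let $N\ge 2$ and let $a,b$ be positive integers with $b>a$, $N\le b-a+1$, and $b/a\in\Psi_N$. Let $V\subset S_{b-a}$ be a general linear subspace of dimension $N$. Then for every nonzero linear subspace $W\subset S_{a-1}$ we have $\mu_V(W)\ge b/a$.
   Context: Over $\mathbb{C}$, fix an affine coordinate $u$ on $\mathbb{P}^1$; $S_a=H^0(\mathcal{O}_{\mathbb{P}^1}(a))$ is identified with polynomials in $u$ of degree at most $a$ (and $S_{-1}=0$). For subspaces $V,W$, $V\cdot W$ is the span of products $fg$ ($f\in V$, $g\in W$); for $V\subset S_{b-a}$ and nonzero $W\subset S_{a-1}$, the filling ratio is $\mu_V(W)=\dim(V\cdot W)/\dim W$. Define $\theta(x)=N-x^{-1}$ with the convention $\theta(\infty)=N$, $\psi_N=\lim_{i\to\infty}\theta^i(\infty)=\frac{N+\sqrt{N^2-4}}{2}$, and $\Psi_N=\{\alpha\in\mathbb{Q}:1<\alpha<\psi_N\}\cup\{\theta^i(\infty):i\ge 0\}\subset\mathbb{Q}\cup\{\infty\}$. ''General'' means in a nonempty Zariski-open subset of the Grassmannian. *)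

(* Defs.v *)
From HB Require Import structures.
From mathcomp Require Import all_boot all_order all_algebra all_field.
Set Implicit Arguments. Unset Strict Implicit. Unset Printing Implicit Defensive.
Import Order.TTheory GRing.Theory Num.Theory.
Local Open Scope ring_scope.

Section Defs.
Variable F : fieldType.

Inductive mxpolyfun (m n : nat) : ('M[F]_(m, n) -> F) -> Prop :=
| pf_const (c : F) : mxpolyfun (fun _ => c)
| pf_coord (i : 'I_m) (j : 'I_n) : mxpolyfun (fun A => A i j)
| pf_add f g : mxpolyfun f -> mxpolyfun g -> mxpolyfun (fun A => f A + g A)
| pf_mul f g : mxpolyfun f -> mxpolyfun g -> mxpolyfun (fun A => f A * g A).

Definition coefmx (n : nat) (s : seq {poly F}) : 'M[F]_(size s, n) :=
  \matrix_(i < size s, j < n) (s`_i)`_j.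

(* Dimension of the span of s, for polynomials of degree < n. *)
Definition dimspan (n : nat) (s : seq {poly F}) : nat := \rank (coefmx n s).

Definition rowpolys (N d : nat) (A : 'M[F]_(N, d)) : seq {poly F} :=
  [seq \sum_(j < d) A i j *: 'X^j | i <- enum 'I_N].

Definition prodspan (vs ws : seq {poly F}) : seq {poly F} :=
  [seq v * w | v <- vs, w <- ws].

(* filling ratio mu_V(W) = dim(V.W)/dim W, V given by spanning set vs,
   W by spanning set ws; all products have degree < b. *)
Definition fillratio (b : nat) (vs ws : seq {poly F}) : rat :=
  (dimspan b (prodspan vs ws))%:R / (dimspan b ws)%:R.

End Defs.

(* theta^(i+1)(infinity) for theta(x) = N - 1/x, theta(infinity) = N *)
Fixpoint theta_iter (N : nat) (i : nat) : rat :=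
  match i with
  | 0 => N%:R
  | i'.+1 => N%:R - (theta_iter N i')^-1
  end.

Definition psiN (N : nat) : algC :=
  (N%:R + sqrtC (N%:R ^+ 2 - 4)) / 2.

Definition inPsi (N : nat) (q : rat) : Prop :=
  (1 < q /\ (ratr q : algC) < psiN N) \/ (exists i : nat, q = theta_iter N i).

(* Main.v *)
Require Import Defs.
From HB Require Import structures.
From mathcomp Require Import all_boot all_order all_algebra all_field.
From mathcomp Require Import zify ring lra.
Import Order.TTheory GRing.Theory Num.Theory.
Local Open Scope ring_scope.

(** A single algebraic certificate bounds all filling ratios at once.  Suppose
    scalar matrices T_0, ..., T_{N-1} with p rows and q columns, q a >= p b, make
    X |-> sum_i v_i T_i X injective on q-tuples X of polynomials of degree < a.
    This map sends W^q into (V.W)^p, so q dim W <= p dim V.W and mu_V(W) >= b/a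
    for every W.  For fixed T injectivity is the nonvanishing of a minor, hence a
    Zariski-open condition on V, and it remains to certify one V for each (a, b).

    - Reflection: from (1, g_0, ..., g_{N-2}) certified for (N a - b, a) one gets
      (1, u^a, ..., u^{(N-2)a}, sum_j u^{ja} g_j) certified for (a, b), the new T
      being the kernel of the old one.  On ratios this is theta, so it reduces
      Psi_N to ratios below N - 1.
    - Passing from V to <1, u^a V> replaces (N, a, b) by (N + 1, a, b + a), which
      reduces ratios below N - 1 to N = 3 and 1 <= b/a < 2.
    - For N = 3 and r = b - a take V = <1, t, u^r>, where the coefficients of t
      are powers of an indeterminate th with strictly concave exponents.  A
      suitable T forces its kernel to vanish, because each coefficient of an
      unknown strictly dominates, in degree in th, some equation it occurs in.
      Then th is specialised. *)

(** * Linear systems with coefficients in V *)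

Section Systems.
Variable R : idomainType.

(** The [j]-th component of sum_i v_i T_i X. Equations and unknowns are indexed by finite types, so
    that block systems are written with sums and products of index types. *)
Definition sys_lhs (N : nat) (v : nat -> {poly R}) (I J : finType)
    (T : nat -> J -> I -> R) (x : I -> {poly R}) (j : J) : {poly R} :=
  \sum_(i < N) \sum_k T i j k *: (v i * x k).

Definition inj_sys N (a : nat) v (I J : finType) T : Prop :=
  forall x : I -> {poly R}, (forall k, (size (x k) <= a)%N) ->
    (forall j, @sys_lhs N v I J T x j = 0) -> forall k, x k = 0.

End Systems.

(* Only [i < N] matters in [v i] and [T i]; here [b = a + d].  The conditions on
   [v 0] and [v N.-1] normalise V so that it can be fed to the reflection. *)
Definition certified (F : fieldType) (N a d : nat) : Prop :=
  exists v : nat -> {poly F}, [/\ v 0%N = 1, size (v N.-1) = d.+1,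
    forall i, (i < N)%N -> (size (v i) <= d.+1)%N &
    exists (I J : finType) (T : nat -> J -> I -> F),
      [/\ (0 < #|J|)%N, (#|J| * (a + d) <= #|I| * a)%N & inj_sys F N a v I J T]].

(** * Elementary rules for certificates *)

Section Rules.
Variable F : fieldType.
Implicit Types (N a d r : nat).

Lemma size_blocks (n a : nat) (x : nat -> {poly F}) :
  (forall i, (i < n)%N -> (size (x i) <= a)%N) ->
  (size (\sum_(i < n) 'X^(i * a) * x i)%R <= n * a)%N.
Proof.
move=> hx; apply: (leq_trans (size_sum _ _ _)); apply/bigmax_leqP => i _.
have [->|nz] := eqVneq (x i) 0; first by rewrite mulr0 size_poly0.
rewrite size_monicM ?monicXn // size_polyXn addSn /=.
apply: (@leq_trans (i * a + a)%N); first by rewrite leq_add2l hx.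
by rewrite addnC -mulSn leq_mul2r ltn_ord orbT.
Qed.

Lemma blocks_eq0 (n a : nat) (x : nat -> {poly F}) :
  (forall i, (i < n)%N -> (size (x i) <= a)%N) ->
  \sum_(i < n) 'X^(i * a) * x i = 0 -> forall i, (i < n)%N -> x i = 0.
Proof.
elim: n x => [//|n IH] x hx; rewrite big_ord_recl mul0n expr0 mul1r.
have -> : \sum_(i < n) 'X^(lift ord0 i * a) * x (lift ord0 i)
        = 'X^a * \sum_(i < n) 'X^(i * a) * x i.+1.
  rewrite big_distrr /=; apply: eq_bigr => i _.
  by rewrite mulrA -exprD /bump /= add1n mulSn.
move=> E.
have x0 : x 0%N = 0.
  apply/polyP => k; rewrite coef0.
  have [lt|ge] := ltnP k a; last by rewrite nth_default // (leq_trans (hx _ _)).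
  by have := congr1 (fun p : {poly F} => p`_k) E; rewrite coefD coefXnM lt addr0 coef0.
move: E; rewrite x0 add0r => /eqP; rewrite mulf_eq0 expf_eq0 polyX_eq0 andbF /= => /eqP E.
case=> [//|i] hi; apply: (IH (fun i => x i.+1)) => // j hj; exact: hx.
Qed.

(** Ratio 1: the single equation X = 0. The reflection ends here when its remainder is 0. *)
Lemma certified_const N a : (0 < N)%N -> certified F N a 0.
Proof.
move=> N0; exists (fun=> 1); split; rewrite ?size_poly1 //.
exists unit, unit, (fun i _ _ => (i == 0%N)%:R); split; rewrite ?card_unit ?addn0 //.
move=> x _ E [] /=; have := E tt; rewrite /sys_lhs.
case: N N0 {E} => // N _; rewrite big_ord_recl [X in _ + X]big1 ?addr0.
  by rewrite (bigD1 tt) //= big1 => [|[]//]; rewrite addr0 scale1r mul1r.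
by move=> i _; rewrite big1 // => k _; rewrite scale0r.
Qed.

(** Ratio N, the starting point theta^0(infinity): with generators u^(ia), one equation in N
    unknowns suffices, since their shifted copies occupy disjoint ranges of exponents. *)
Lemma certified_max N a : (0 < N)%N -> certified F N a (N.-1 * a).
Proof.
move=> N0; exists (fun i => 'X^(i * a)); split; rewrite ?size_polyXn //.
  by move=> i hi; rewrite size_polyXn ltnS leq_mul2r -ltnS prednK // hi orbT.
exists 'I_N, unit, (fun i _ (k : 'I_N) => (i == k :> nat)%:R).
split; rewrite ?card_unit ?card_ord ?mul1n -?mulSn ?prednK //.
move=> x hx E k; have := E tt; rewrite /sys_lhs.
pose y i := if insub i is Some k then x k else 0.
have yE (i : 'I_N) : y i = x i by rewrite /y valK.
move=> E0; rewrite -yE; apply: (@blocks_eq0 N a y) => // [i hi|].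
  by rewrite /y insubT; apply: hx.
rewrite -[RHS]E0; apply: eq_bigr => i _; rewrite (bigD1 i) //= eqxx scale1r yE.
rewrite big1 ?addr0 // => l ne; rewrite -val_eqE /= in ne.
by rewrite eq_sym (negPf ne) scale0r.
Qed.

(** The extra generator gets the matrix 0. It repeats the last one, so that the last generator still
    has degree exactly [d]. *)
Lemma certified_widen N a d : (0 < N)%N -> certified F N a d -> certified F N.+1 a d.
Proof.
move=> N0 [v [v0 vN vi [I [J [T [J0 c inj]]]]]].
exists (fun i => if (i < N)%N then v i else v N.-1); split.
- by rewrite N0.
- by rewrite /= ltnn.
- by move=> i _; case: ifP => [/vi//|_]; rewrite vN.
exists I, J, (fun i j k => if (i < N)%N then T i j k else 0); split=> // x hx E.
apply: inj => // j; rewrite -[RHS](E j) /sys_lhs big_ord_recr /= ltnn.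
rewrite [X in _ + X]big1 ?addr0 => [|k _]; last by rewrite scale0r.
by apply: eq_bigr => i _; apply: eq_bigr => k _; rewrite ltn_ord.
Qed.

(** One new unknown per equation turns the system into x_j + u^a * (old system)_j = 0. The
    coefficients below u^a kill x_j, and u^a cancels from the rest. The quotient of unknowns by
    equations grows by 1. *)
Lemma certified_add N a d :
  (0 < N)%N -> certified F N a d -> certified F N.+1 a (d + a).
Proof.
move=> N0 [v [v0 vN vi [I [J [T [J0 c inj]]]]]].
have hs i (hi : (i < N)%N) : (size ('X^a * v i)%R <= (d + a).+1)%N.
  have [->|nz] := eqVneq (v i) 0; first by rewrite mulr0 size_poly0.
  by rewrite size_monicM ?monicXn // size_polyXn addSn /= addnC -addSn leq_add2r vi.
exists (fun i => if i is i'.+1 then 'X^a * v i' else 1); split=> //.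
- case: N N0 vN {vi c inj hs} => // N _ vN.
  rewrite /= size_monicM ?monicXn //.
    by rewrite vN size_polyXn; lia.
  by rewrite -size_poly_gt0 vN.
- by case=> [|i] hi; rewrite ?size_poly1 // hs.
exists (J + I)%type, J, (fun i j k =>
  match i, k with
  | 0%N, inl j' => (j == j')%:R | i'.+1, inr k' => T i' j k' | _, _ => 0 end).
split=> //; first by rewrite card_sum; nia.
move=> x hx E.
have Ej j : x (inl j) + 'X^a * sys_lhs F N v I J T (fun k => x (inr k)) j = 0.
  rewrite -[RHS](E j) /sys_lhs big_ord_recl; congr (_ + _).
    rewrite big_sumType /= [X in _ + X]big1 ?addr0; last by move=> k _; rewrite scale0r.
    rewrite (bigD1 j) //= eqxx scale1r mul1r big1 ?addr0 //. move=> l ne.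
    by rewrite eq_sym (negPf ne) scale0r.
  rewrite big_distrr /=; apply: eq_bigr => i _.
  rewrite big_sumType /= [X in _ = X + _]big1 ?add0r; last by move=> k _; rewrite scale0r.
  rewrite mulr_sumr; apply: eq_bigr => k _.
  by rewrite -scalerAr mulrA.
have xl j : x (inl j) = 0.
  apply/polyP => k; rewrite coef0.
  have [lt|ge] := ltnP k a; last by rewrite nth_default // (leq_trans (hx _)).
  have := congr1 (fun p : {poly F} => p`_k) (Ej j).
  by rewrite coefD coefXnM lt addr0 coef0.
have xr : forall k, x (inr k) = 0.
  apply: inj => // j; have := Ej j; rewrite xl add0r => /eqP.
  by rewrite mulf_eq0 expf_eq0 polyX_eq0 andbF /= => /eqP.
by case.
Qed.

(** The columns of [K] are a basis of the kernel of [S], and the left inverse [G] records their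
    independence. *)
Lemma kernel_family (A B : finType) (S : B -> A -> F) :
  exists q (K : A -> 'I_q -> F), [/\ (#|A| <= q + #|B|)%N,
    forall b l, \sum_z S b z * K z l = 0 &
    exists G : 'I_q -> A -> F, forall l l', \sum_z G l z * K z l' = (l == l')%:R].
Proof.
pose M : 'M[F]_(#|A|, #|B|) := \matrix_(i, j) S (enum_val j) (enum_val i).
pose L := row_base (kermx M).
have LM : L *m M = 0.
  by apply/sub_kermxP; rewrite eq_row_base.
have /row_freeP [D LD] : row_free L by rewrite row_base_free.
exists (\rank (kermx M)), (fun (z : A) l => L l (enum_rank z)); split.
- by rewrite mxrank_ker addnC -leq_subLR leq_sub2l // rank_leq_col.
- move=> b l; have := congr1 (fun X : 'M_(_, _) => X l (enum_rank b)) LM.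
  rewrite !mxE (reindex _ (onW_bij _ (@enum_rank_bij A))) /= => LM0.
  by rewrite -[RHS]LM0; apply: eq_bigr => z _; rewrite [M _ _]mxE !enum_rankK mulrC.
exists (fun l (z : A) => D (enum_rank z) l) => l l'.
have := congr1 (fun X : 'M_(_, _) => X l' l) LD.
rewrite !mxE (reindex _ (onW_bij _ (@enum_rank_bij A))) /= eq_sym => <-.
by apply: eq_bigr => z _; rewrite mulrC.
Qed.

End Rules.

(** * The reflection (N a - b, a) to (a, b) *)

Section Reflection.
Variable F : fieldType.

(* The syzygies of (1, u^a, ..., u^{na}, G) in degree < a are the multiples of
   (- g_0, ..., - g_n, 1): comparing top degrees bounds [y]. *)
Lemma reflect_syzygy (n a r : nat) (g x : nat -> {poly F}) (y : {poly F}) :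
  (r < a)%N -> (forall i, (i < n.+1)%N -> (size (g i) <= r.+1)%N) ->
  size (\sum_(i < n.+1) 'X^(i * a) * g i) = (n * a + r).+1 ->
  (forall i, (i < n.+1)%N -> (size (x i) <= a)%N) ->
  \sum_(i < n.+1) 'X^(i * a) * x i + (\sum_(i < n.+1) 'X^(i * a) * g i) * y = 0 ->
  (size y <= a - r)%N /\ forall i, (i < n.+1)%N -> x i = - (g i * y).
Proof.
move=> ra hg; set G := \sum_(i < _) _ * g _ => sG hx E.
have [y0|y0] := eqVneq y 0.
  split=> [|i hi]; first by rewrite y0 size_poly0.
  rewrite y0 mulr0 oppr0; apply: (blocks_eq0 F _ _ _ hx _ _ hi).
  by move: E; rewrite y0 mulr0 addr0.
have G0 : G != 0 by rewrite -size_poly_gt0 sG.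
have sy : (size y <= a - r)%N.
  have : (size (G * y)%R <= n.+1 * a)%N.
    have -> : G * y = - \sum_(i < n.+1) 'X^(i * a) * x i.
      by apply/eqP; rewrite -addr_eq0 addrC E.
    by rewrite size_polyN size_blocks.
  rewrite size_mul // sG mulSn addSn -addnA -pred_Sn addnC leq_add2r => h; rewrite -(leq_add2r r) subnK ?(ltnW ra) // addnC. exact: h.
split=> // i hi; apply/eqP; rewrite -addr_eq0; apply/eqP.
move: i hi; apply: (@blocks_eq0 F n.+1 a (fun i => x i + g i * y)) => [i hi|].
  rewrite (leq_trans (size_polyD _ _)) // geq_max hx //=.
  apply: (leq_trans (size_polyMleq _ _)); have := hg i hi; lia.
rewrite -[RHS]E mulr_suml -big_split /=; apply: eq_bigr => i _.
by rewrite mulrDr mulrA.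
Qed.

(** The old T is read as a linear map from N copies of F^I to F^J. A basis of its kernel, of at
    least N |I| - |J| vectors, indexes the new unknowns, and [I] indexes the new equations. Each new
    equation is a syzygy, hence given by one multiplier Y_k. *)
Lemma certified_reflect (n a r : nat) : (r < a)%N ->
  certified F n.+2 (a - r) r -> certified F n.+2 a (n * a + r).
Proof.
move=> ra [v [v0 vN vi [I [J [T [J0 c inj]]]]]].
pose G := \sum_(i < n.+1) 'X^(i * a) * v i.+1.
have sG : size G = (n * a + r).+1.
  rewrite /G big_ord_recr /= addrC size_polyDl size_monicM ?monicXn //.
  - by rewrite size_polyXn vN; lia.
  - by rewrite -size_poly_gt0 vN.
  - rewrite size_polyXn vN.
    apply: (leq_ltn_trans (@size_blocks F n a (fun i => v i.+1) _)); last by lia.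
    by move=> i hi; apply: (leq_trans (vi _ _)) => //; lia.
  - by rewrite -size_poly_gt0 vN.
pose A := ('I_n.+2 * I)%type.
(* Slot i <= n, the multiplier of u^(ia), stands for v_(i+1); the last slot, the multiplier of [G],
   stands for v_0 = 1. The signs are those of the syzygy (- v_1, ..., - v_(n+1), 1). *)
pose S (b : J) (z : A) : F :=
  if (z.1 < n.+1)%N then - T z.1.+1 b z.2 else T 0%N b z.2.
have [q [K [cK SK [L LK]]]] := kernel_family F _ _ S.
exists (fun i => if (i < n.+1)%N then 'X^(i * a) else G); split.
- by rewrite mul0n expr0.
- by rewrite /= ltnn sG.
- move=> i hi; case: ifP => h; last by rewrite sG.
  by rewrite size_polyXn ltnS (leq_trans _ (leq_addr _ _)) // leq_mul2r -ltnS h orbT.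
exists 'I_q, I, (fun i k l => K (inord i, k) l).
have cA : #|{: A}| = (n.+2 * #|I|)%N by rewrite card_prod card_ord.
rewrite cA in cK; rewrite card_ord subnK ?(ltnW ra) // in c *.
have I0 : (0 < #|I|)%N.
  by case: (posnP #|I|) => // I0; move: c; rewrite I0 mul0n leqn0 muln_eq0; lia.
split=> //.
  have h : (#|I| * (a - r) + #|I| * r = #|I| * a)%N by rewrite -mulnDr subnK // ltnW.
  have h2 : (n.+2 * #|I| * a <= q * a + #|J| * a)%N by rewrite -mulnDl leq_mul2r cK orbT.
  have h3 : (n.+2 * #|I| * a = #|I| * (a + n * a) + #|I| * a)%N.
    rewrite !mulSn; nia.
  rewrite addnA mulnDr; lia.
move=> x hx E.
pose X (z : A) : {poly F} := \sum_l K z l *: x l.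
have sX z : (size (X z) <= a)%N.
  apply: (leq_trans (size_sum _ _ _)); apply/bigmax_leqP => l _.
  exact: leq_trans (size_scale_leq _ _) (hx l).
pose Y k := X (ord_max, k).
have EX k : \sum_(i < n.+1) 'X^(i * a) * X (inord i, k) + G * Y k = 0.
  rewrite -[RHS](E k) /sys_lhs [RHS]big_ord_recr /= ltnn; congr (_ + _).
    apply: eq_bigr => i _; rewrite ltn_ord /X mulr_sumr.
    by apply: eq_bigr => l _; rewrite -scalerAr.
  rewrite /Y /X mulr_sumr; apply: eq_bigr => l _.
  by rewrite -scalerAr; congr (K (_, _) _ *: _); apply: val_inj; rewrite /= inordK.
have hv i (hi : (i < n.+1)%N) : (size (v i.+1) <= r.+1)%N by apply: vi.
have key k := @reflect_syzygy n a r (fun i => v i.+1)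
  (fun i => X (inord i, k)) (Y k) ra hv sG (fun i _ => sX _) (EX k).
(* Substituting the syzygies into the kernel relation gives the old system evaluated at [Y]. *)
have Y0 : forall k, Y k = 0.
  apply: (inj Y) => [k|b]; first by case: (key k).
  have SX : \sum_z S b z *: X z = 0.
    under eq_bigr => z _ do rewrite /X scaler_sumr.
    rewrite exchange_big big1 //= => l _.
    under eq_bigr => z _ do rewrite scalerA.
    by rewrite -scaler_suml SK scale0r.
  have SX2 : \sum_i \sum_k S b (i, k) *: X (i, k) = 0.
    by rewrite -[RHS]SX pair_bigA; apply: eq_bigr => -[].
  rewrite -[RHS]SX2 /sys_lhs.
  rewrite big_ord_recl [RHS]big_ord_recr /= addrC; congr (_ + _).
    by apply: eq_bigr => k _; rewrite /S /= ltnn v0 mul1r.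
  apply: eq_bigr => i _; apply: eq_bigr => k _; rewrite /S /= ltn_ord.
  have [_ /(_ i (ltn_ord i)) h] := key k.
  have -> : widen_ord (leqnSn n.+1) i = inord i :> 'I_n.+2.
    by apply: val_inj; rewrite /= inordK // ltnS ltnW.
  by rewrite h scalerN scaleNr opprK.
have X0 z : X z = 0.
  case: z => i k; have [lt|ge] := ltnP i n.+1.
    have [_ /(_ i lt)] := key k; rewrite inord_val => ->.
    by rewrite Y0 mulr0 oppr0.
  rewrite -[RHS](Y0 k); congr (X (_, _)); apply: val_inj => /=.
  by have := ltn_ord i; lia.
move=> l.
transitivity (\sum_z L l z *: X z); last by rewrite big1 // => z _; rewrite X0 scaler0.
under eq_bigr => z _ do rewrite /X scaler_sumr.
rewrite exchange_big /= (bigD1 l) //= [X in _ = _ + X]big1 ?addr0.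
  under eq_bigr => z _ do rewrite scalerA.
  by rewrite -scaler_suml LK eqxx scale1r.
move=> l' ne; under eq_bigr => z _ do rewrite scalerA.
by rewrite -scaler_suml LK eq_sym (negPf ne) scale0r.
Qed.

End Reflection.

(** * Three generators: domination of degrees *)

Section Tropical.
Variable F : fieldType.

(* [p x] and [q x] are the coefficients of two unknowns.  Row [z] is dominated by
   [p z] when [z < o] and by [q (z - o)] otherwise, as the strictly concave [w]
   makes [l = o] the unique maximum of [w l - 2 s l]. *)
Lemma dominant_rows (r o cP cQ : nat) (w : nat -> nat) (s M : int)
    (alP alQ : nat -> int) (p q : nat -> {poly F}) :
  (o <= r)%N ->
  (forall l : nat, (l < r)%N -> l != o -> (w l)%:Z - s * (2 * l%:Z) < (w o)%:Z - s * (2 * o%:Z)) ->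
  cP%:Z - cQ%:Z = (w o)%:Z + s * (2 * o%:Z - 2 * r%:Z) ->
  (forall x : nat, (x < o)%N -> alP x = s * (2 * x%:Z + 1 - 2 * o%:Z)) ->
  (forall x : nat, (o <= x)%N -> alP x < s * (2 * x%:Z + 1 - 2 * o%:Z)) ->
  (forall x : nat, (x < r - o)%N -> alQ x = s * (2 * x%:Z + 1 - 2 * (r%:Z - o%:Z))) ->
  (forall x : nat, alQ x <= s * (2 * x%:Z + 1 - 2 * (r%:Z - o%:Z))) ->
  (forall (x n : nat), M + 1 + alP x <= n%:Z -> (p x)`_n = 0) ->
  (forall (x n : nat), M + 1 + alQ x <= n%:Z -> (q x)`_n = 0) ->
  (forall z : nat, (z < r)%N ->
     'X^cP * p z + \sum_(l < z.+1) 'X^(cQ + w l) * q (z - l)%N = 0) ->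
  (forall x n : nat, (x < o)%N -> M + alP x <= n%:Z -> (p x)`_n = 0) /\
  (forall x n : nat, (x < r - o)%N -> M + alQ x <= n%:Z -> (q x)`_n = 0).
Proof.
move=> or hw hc hP1 hP2 hQ1 hQ2 Hp Hq row; split=> x n hx hn.
  (* Here every l <= x differs from [o]. Strictness in [hw], between integers, is worth one unit of
     degree and turns the bound M + 1 into M. *)
  have := congr1 (fun f : {poly F} => f`_(cP + n)) (row x (leq_trans hx or)).
  rewrite coefD coefXnM ltnNge leq_addr /= addKn coef_sum big1 ?addr0 ?coef0 //.
  move=> [l /= hl] _; rewrite coefXnM; case: ltnP => // hl2; apply: Hq.
  have := hw l; have := hQ2 (x - l)%N; rewrite (hP1 x hx) in hn.
  rewrite -!subzn // ?PoszD => h1 h2.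
  have {}h2 : (w l)%:Z - s * (2 * l%:Z) < (w o)%:Z - s * (2 * o%:Z) by apply: h2; lia.
  nia.
(* In row x + o the term l = o carries [q x]; the [p] term drops because [alP] is strictly below the
   line from index [o] on. *)
have hz : (x + o < r)%N by lia.
have := congr1 (fun f : {poly F} => f`_(cQ + w o + n)) (row (x + o)%N hz).
rewrite coefD coef_sum.
have ho : (o < (x + o).+1)%N by rewrite ltnS leq_addl.
rewrite (bigD1 (Ordinal ho)) //= big1 ?addr0 => [|[l /= hl] ne].
  rewrite [in X in _ + X]coefXnM ltnNge leq_addr /= addKn addnK coefXnM coef0.
  case: ltnP => [_|hl2]; first by rewrite add0r.
  rewrite Hp ?add0r //.
  have := hP2 (x + o)%N (leq_addl _ _); rewrite (hQ1 x hx) in hn.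
  by rewrite -!subzn // ?PoszD; nia.
rewrite coefXnM; case: ltnP => // hl2; apply: Hq.
have := hw l; have := hQ2 (x + o - l)%N; rewrite (hQ1 x hx) in hn.
rewrite -!subzn // ?PoszD => h1 h2.
have {}h2 : (w l)%:Z - s * (2 * l%:Z) < (w o)%:Z - s * (2 * o%:Z).
  apply: h2; first lia.
  by apply: contraNneq ne => e; apply/eqP/val_inj.
by nia.
Qed.


(* An unknown y has its [L] lowest coefficients killed by a condition at u = 0 and
   its [e] highest ones by a condition at u = infinity.  The potential is a
   concave piecewise linear function of the index, with its break between [L - 1]
   and [L]; the terms +1 and -1 keep the two slopes distinct when both minima
   equal r / 2. *)
Definition low_slope (r L : nat) : int := 4 * (r%:Z - (minn L (r - L))%:Z) + 1.
Definition high_slope (r e : nat) : int := 4 * (minn e (r - e))%:Z - 1.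
Definition potential (r L e x : nat) : int :=
  (if (x < L)%N then low_slope r L else high_slope r e) * (2 * x%:Z + 1 - 2 * L%:Z).

(** The outer variable is u, the inner one th, and the degree bounded is that in th. [M] is an
    integer because it will descend to minus infinity, which forces y = 0. *)
Definition deg_below (r L e : nat) (M : int) (y : {poly {poly F}}) : Prop :=
  forall x n : nat, M + potential r L e x <= n%:Z -> (y`_x)`_n = 0.

(** The exponents of th in t. For either slope s = 4 j + 1 or s = 4 j - 1, the only maximum of
    [tweight r l] - 2 s l over integers is at l = r - j, so the perturbations of the slopes do no
    harm. *)
Definition tweight (r l : nat) : nat := (4 * l * (r.*2 - l))%N.
Definition tpoly (r : nat) : {poly {poly F}} := \poly_(l < r.+1) 'X^(tweight r l).

Lemma tweightE (r l : nat) : (l <= r)%N ->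
  (tweight r l)%:Z = 4 * l%:Z * (2 * r%:Z - l%:Z).
Proof.
by move=> lr; rewrite /tweight !PoszM -subzn ?addnn -?mul2n ?PoszM //; lia.
Qed.

(** Below u^r the right-hand side vanishes, which leaves r rows for the [o] lowest coefficients of
    [P] and the r - o lowest of [Q]. Both low slopes are 4 (r - o) + 1, and both high slopes are
    smaller. *)
Lemma low_rows (r o e1 e2 : nat) (M : int) (P Q X : {poly {poly F}}) :
  (o <= r - o)%N -> (o <= r)%N -> (e1 <= r)%N -> (e2 <= r)%N ->
  deg_below r o e1 (M + 1) P -> deg_below r (r - o) e2 (M + 1) Q ->
  'X^(tweight r o) *: P + 'X^((4 * (r - o) + 1) * (2 * (r - o))) *: (tpoly r * Q)
    = 'X^r * X ->
  (forall x n : nat, (x < o)%N -> M + potential r o e1 x <= n%:Z -> (P`_x)`_n = 0) /\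
  (forall x n : nat, (x < r - o)%N ->
     M + potential r (r - o) e2 x <= n%:Z -> (Q`_x)`_n = 0).
Proof.
move=> oo or he1 he2 HP HQ E.
have hm : minn o (r - o) = o by apply/minn_idPl.
have hm2 : minn (r - o) (r - (r - o)) = o by rewrite subKn // minnC.
have hb1 : (minn e1 (r - e1) <= r - o)%N by lia.
have hb2 : (minn e2 (r - e2) <= r - o)%N by lia.
apply: (@dominant_rows r o (tweight r o) ((4 * (r - o) + 1) * (2 * (r - o))) (tweight r)
  (4 * (r%:Z - o%:Z) + 1)) => //.
- move=> l lr lo; rewrite !tweightE //; last exact: ltnW.
  by nia.
- rewrite tweightE //; nia.
- by move=> x hx; rewrite /potential hx /low_slope hm.
- move=> x hx; rewrite /potential ltnNge hx /= /high_slope; nia.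
- by move=> x hx; rewrite /potential hx /low_slope hm2 -subzn.
- move=> x; rewrite /potential; case: ltnP => hx.
    by rewrite /low_slope hm2 -subzn.
  by rewrite -subzn //; rewrite /high_slope; nia.
move=> z hz; have := congr1 (fun f : {poly {poly F}} => f`_z) E.
rewrite coefXnM hz coefD !coefZ coefM => E0; rewrite -[RHS]E0; congr (_ + _).
rewrite mulr_sumr; apply: eq_bigr => -[l hl] _ /=.
rewrite coef_poly ifT; last by lia.
by rewrite mulrA -exprD.
Qed.

(** The mirror image at u = infinity: [X] has no terms in u^a, ..., u^(a+r-1), and coefficients are
    read downwards. Both high slopes are 4 o - 1, which the reversal turns into s = 1 - 4 o. *)
Lemma high_rows (r o L1 L2 a : nat) (M : int) (P Q P' Q' X : {poly {poly F}}) :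
  (o <= r - o)%N -> (o <= r)%N -> (r <= a)%N -> (L1 <= r)%N -> (L2 <= r)%N ->
  (L1 + o <= a)%N -> (L2 + (r - o) <= a)%N ->
  P' = 'X^(a - (L1 + o)) * P -> Q' = 'X^(a - (L2 + (r - o))) * Q ->
  (size Q' <= a)%N -> (size X <= a)%N ->
  deg_below r L1 o (M + 1) P -> deg_below r L2 (r - o) (M + 1) Q ->
  'X^(4 * (r - o) * (r + o) + 8 * o * (r - o)) *: ('X^r * P')
    + 'X^(2 * (r - o)) *: (tpoly r * Q') = X ->
  (forall x n : nat, (L1 <= x < L1 + o)%N ->
     M + potential r L1 o x <= n%:Z -> (P`_x)`_n = 0) /\
  (forall x n : nat, (L2 <= x < L2 + (r - o))%N ->
     M + potential r L2 (r - o) x <= n%:Z -> (Q`_x)`_n = 0).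
Proof.
move=> oo or ra hL1 hL2 hD1 hD2 eP eQ sQ sX HP HQ E.
have hm : minn o (r - o) = o by apply/minn_idPl.
have hm2 : minn (r - o) (r - (r - o)) = o by rewrite subKn // minnC.
have hb1 : (minn L1 (r - L1) <= r - o)%N by lia.
have hb2 : (minn L2 (r - L2) <= r - o)%N by lia.
pose s : int := 1 - 4 * o%:Z.
pose D1 := (L1 + o)%N; pose D2 := (L2 + (r - o))%N.
pose p z := P'`_(a - 1 - z); pose q z := Q'`_(a - 1 - z).
have pE z : (z < a)%N -> p z = if (z < D1)%N then P`_(D1 - 1 - z) else 0.
  move=> hz; rewrite /p eP coefXnM; case: ltnP => h; case: ltnP => h'; rewrite /D1 in h' *; try (by []); try (clear -h h' hz hD1; lia).
  by congr (P`_ _); clear -h h' hz hD1; lia.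
have qE z : (z < a)%N -> q z = if (z < D2)%N then Q`_(D2 - 1 - z) else 0.
  move=> hz; rewrite /q eQ coefXnM; case: ltnP => h; case: ltnP => h'; rewrite /D2 in h' *; try (by []); try (clear -h h' hz hD2; lia).
  by congr (Q`_ _); clear -h h' hz hD2; lia.
(* From [D1] on the coefficient is 0 and any bound holds; the value chosen is one below the line, as
   [dominant_rows] asks. The same is done for [alQ] from [D2] on. *)
pose alP z := if (z < D1)%N then potential r L1 o (D1 - 1 - z)
  else s * (2 * z%:Z + 1 - 2 * o%:Z) - 1.
pose alQ z := if (z < D2)%N then potential r L2 (r - o) (D2 - 1 - z)
  else s * (2 * z%:Z + 1 - 2 * (r%:Z - o%:Z)) - 1.
pose p0 z := if (z < D1)%N then P`_(D1 - 1 - z) else 0.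
pose q0 z := if (z < D2)%N then Q`_(D2 - 1 - z) else 0.
have [] := @dominant_rows r o (4 * (r - o) * (r + o) + 8 * o * (r - o)) (2 * (r - o))
  (fun l => tweight r (r - l)) s M alP alQ p0 q0 or.
- move=> l lr lo; rewrite !tweightE ?leq_subr // /s -!subzn //; last exact: ltnW.
  by nia.
- rewrite tweightE ?leq_subr // /s -!subzn //; nia.
- move=> x hx; rewrite /alP ifT; last by rewrite /D1; lia.
  rewrite /potential ifF; last by rewrite /D1; lia.
  by rewrite /high_slope hm /s /D1 -!subzn ?PoszD; try lia.
- move=> z hz; rewrite /alP; case: ltnP => h; last by lia.
  rewrite /potential ifT; last by rewrite /D1 in h *; lia.
  have hy : 2 * o%:Z - 1 - 2 * z%:Z < 0 by lia.
  have hs : 4 * o%:Z - 1 < low_slope r L1 by rewrite /low_slope; lia.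
  rewrite (_ : _ - 2 * L1%:Z = 2 * o%:Z - 1 - 2 * z%:Z); last by rewrite /D1 in h *; lia.
  have hys : low_slope r L1 * (2 * o%:Z - 1 - 2 * z%:Z)
      < (4 * o%:Z - 1) * (2 * o%:Z - 1 - 2 * z%:Z) by rewrite ltr_nM2r.
  apply: (lt_le_trans hys); rewrite /s le_eqVlt; apply/orP; left; apply/eqP; ring.
- move=> x hx; rewrite /alQ ifT; last by rewrite /D2; lia.
  rewrite /potential ifF; last by rewrite /D2; lia.
  by rewrite /high_slope hm2 /s /D2 -!subzn ?PoszD -?subzn; try lia.
- move=> z; rewrite /alQ; case: ltnP => h; last by lia.
  rewrite /potential; case: ltnP => h'.
    have hy : 2 * (r%:Z - o%:Z) - 1 - 2 * z%:Z <= 0 by rewrite /D2 in h h'; lia.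
    have hs : 4 * o%:Z - 1 <= low_slope r L2 by rewrite /low_slope; lia.
    have hys := ler_wnM2r hy hs; rewrite (_ : _ - _ = 2 * (r%:Z - o%:Z) - 1 - 2 * z%:Z).
      by apply: (le_trans hys); rewrite /s le_eqVlt; apply/orP; left; apply/eqP; ring.
    by rewrite /D2 in h h' *; lia.
  rewrite /high_slope hm2 /s /D2 in h h' *; rewrite -!subzn ?PoszD -?subzn; try lia.
- move=> x n; rewrite /p0 /alP; case: ltnP => h hn; last by rewrite coef0.
  exact: HP.
- move=> x n; rewrite /q0 /alQ; case: ltnP => h hn; last by rewrite coef0.
  exact: HQ.
- move=> z hz; rewrite /p0 -pE; last by lia.
  have EX : X`_(a + r - 1 - z) = 0 by rewrite nth_default //; apply: (leq_trans sX); lia.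
  rewrite -[RHS]EX -E coefD !coefZ coefXnM ifF; last by lia.
  congr (_ * _ + _); first by rewrite /p; congr (P'`_ _); clear -hz ra; lia.
  rewrite /tpoly poly_def mulr_suml coef_sum mulr_sumr.
  rewrite [RHS](reindex_inj rev_ord_inj) /=.
  rewrite (big_ord_widen_cond r.+1 xpredT
    (fun l => 'X^(2 * (r - o) + tweight r (r - l)) * q0 (z - l)%N)); last by lia.
  rewrite big_mkcond /=; apply: eq_bigr => -[l hl] _ /=.
  rewrite subSS -scalerAl coefZ coefXnM [X in _ * (_ * X)]ifF; last by lia.
  case: ltnP => hlz; last first.
    by rewrite nth_default ?mulr0 //; apply: (leq_trans sQ); clear -hlz hl hz ra; lia.
  rewrite mulrA -exprD /q0 -qE; last by lia.
  rewrite /q; have -> : (a - 1 - (z - l) = a + r - 1 - z - (r - l))%N.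
    by clear -hlz hl hz ra; lia.
  by [].
move=> h1 h2; split=> x n hx hn.
  have := h1 (D1 - 1 - x)%N n; rewrite /p0 /alP !ifT; try by rewrite /D1; lia.
  have -> : (D1 - 1 - (D1 - 1 - x) = x)%N by rewrite /D1; lia.
  by apply=> //; rewrite /D1; lia.
have := h2 (D2 - 1 - x)%N n; rewrite /q0 /alQ !ifT; try by rewrite /D2; lia.
have -> : (D2 - 1 - (D2 - 1 - x) = x)%N by rewrite /D2; lia.
by apply=> //; rewrite /D2; lia.
Qed.

End Tropical.

(** * Chains of linked unknowns and descent on the degree in th *)

Section TropicalChain.
Variable F : fieldType.

(** Here and in [high_form] the powers of th differ by the value of cP - cQ prescribed in
    [dominant_rows], so that dominance passes from [P] to [Q] at row [o]. *)
Definition low_form (r o : nat) (P Q : {poly {poly F}}) : {poly {poly F}} :=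
  'X^(tweight r o) *: P + 'X^((4 * (r - o) + 1) * (2 * (r - o))) *: (tpoly F r * Q).

Definition high_form (r o : nat) (P Q : {poly {poly F}}) : {poly {poly F}} :=
  'X^(4 * (r - o) * (r + o) + 8 * o * (r - o)) *: ('X^r * P)
    + 'X^(2 * (r - o)) *: (tpoly F r * Q).

Lemma deg_below_mono (r L e : nat) (M M' : int) (y : {poly {poly F}}) :
  M <= M' -> deg_below F r L e M y -> deg_below F r L e M' y.
Proof. by move=> MM H x n hn; apply: H; apply: le_trans hn; rewrite lerD2r. Qed.

Lemma uniform_bound (P : nat -> int -> Prop) (n : nat) :
  (forall i M M', M <= M' -> P i M -> P i M') -> (forall i, exists M, P i M) ->
  exists M, forall i, (i < n)%N -> P i M.
Proof.
move=> mono ex; elim: n => [|n [M HM]]; first by exists 0.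
have [M' HM'] := ex n; exists (Num.max M M') => i.
rewrite ltnS leq_eqVlt => /orP [/eqP ->|lt].
  by apply: mono HM'; rewrite le_max lexx orbT.
by apply: mono (HM i lt); rewrite le_max lexx.
Qed.

Lemma deg_below_exists (r L e : nat) (y : {poly {poly F}}) :
  exists M, deg_below F r L e M y.
Proof.
pose P x M := forall n : nat, M + potential r L e x <= n%:Z -> (y`_x)`_n = 0.
have [||M HM] := @uniform_bound P (size y).
- by move=> x M M' MM H n hn; apply: H; apply: le_trans hn; rewrite lerD2r.
- move=> x; exists ((size y`_x)%:Z - potential r L e x) => n.
  by rewrite subrK lez_nat => hn; rewrite nth_default.
exists M => x n; have [lt|ge] := ltnP x (size y); first exact: HM.
by rewrite [y`_x]nth_default // coef0.
Qed.

Lemma deg_below_eq0 (r L e : nat) (y : {poly {poly F}}) :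
  (forall M, deg_below F r L e M y) -> y = 0.
Proof.
move=> H; apply/polyP => x; apply/polyP => n; rewrite !coef0.
by apply: (H (- potential r L e x)); rewrite addNr.
Qed.

Section Chain.
Variables (r a : nat).
Hypotheses (r0 : (0 < r)%N) (ra : (r <= a)%N).

(* The index k such that a - r + k is the last link, below a, of the chain
   l, l + r, l + 2r, ... *)
Definition last_link (l : nat) : nat :=
  if (a %% r <= l)%N then (l - a %% r)%N else (l + r - a %% r)%N.

Lemma last_link_lt l : (l < r)%N -> (last_link l < r)%N.
Proof. by move=> lr; rewrite /last_link; have := ltn_pmod a r0; case: ifP; lia. Qed.

Lemma last_linkK l : (l < r)%N -> ((a - r + last_link l) %% r)%N = l.
Proof.
move=> lr; rewrite /last_link; have := divn_eq a r; have := ltn_pmod a r0.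
have : (0 < a %/ r)%N by rewrite divn_gt0.
move: (a %/ r)%N (a %% r)%N => q s q0 sr E; case: leqP => h.
  have -> : (a - r + (l - s) = q.-1 * r + l)%N.
    by rewrite E -{1}(prednK q0) mulSn; lia.
  by rewrite modnMDl modn_small.
have -> : (a - r + (l + r - s) = q * r + l)%N.
  by rewrite E -(prednK q0) mulSn; lia.
by rewrite modnMDl modn_small.
Qed.

Lemma mod_last_link k : (k < r)%N -> last_link ((a - r + k) %% r)%N = k.
Proof.
move=> kr; rewrite /last_link; have := divn_eq a r; have := ltn_pmod a r0.
have : (0 < a %/ r)%N by rewrite divn_gt0.
move: (a %/ r)%N (a %% r)%N => q s q0 sr E.
have [h|h] := ltnP (s + k) r.
  have -> : (a - r + k = q.-1 * r + (s + k))%N.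
    by rewrite E -{1}(prednK q0) mulSn; lia.
  by rewrite modnMDl modn_small // leq_addr addKn.
have -> : (a - r + k = q * r + (s + k - r))%N.
  by rewrite E -(prednK q0) mulSn; lia.
rewrite modnMDl modn_small; last by lia.
by rewrite ifF; lia.
Qed.

Lemma chain_link (Y : nat -> {poly {poly F}}) :
  (forall j, (r <= j < a)%N -> Y j = 'X^r * Y (j - r)%N) ->
  forall j, (j < a)%N -> Y j = 'X^(j - j %% r) * Y (j %% r)%N.
Proof.
move=> HY j; elim/ltn_ind: j => j IH ja.
have [lt|ge] := ltnP j r; first by rewrite modn_small // subnn expr0 mul1r.
rewrite HY ?ge // IH; [|lia|lia].
have -> : (j %% r = (j - r) %% r)%N by rewrite -{1}(subnK ge) modnDr.
rewrite mulrA -exprD; congr ('X^_ * _).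
by have := leq_mod (j - r) r; lia.
Qed.

(* The unknowns Y_j, Z_j are linked by Y_j = u^r Y_{j-r}, so that Y_j with j near a
   sees the top coefficients of Y_{j mod r}.  Each [low] equation couples the
   bottoms of one Y and one Z, each [high] equation couples two tops; the unknown
   with fewer coefficients to kill is the one not multiplied by t. *)
Variables (Y Z X X' : nat -> {poly {poly F}}).
Hypotheses
  (sY : forall j, (j < a)%N -> (size (Y j) <= a)%N)
  (sZ : forall j, (j < a)%N -> (size (Z j) <= a)%N)
  (sX' : forall j, (j < r)%N -> (size (X' j) <= a)%N)
  (cY : forall j, (r <= j < a)%N -> Y j = 'X^r * Y (j - r)%N)
  (cZ : forall j, (r <= j < a)%N -> Z j = 'X^r * Z (j - r)%N)
  (low1 : forall k, (k < r)%N -> (k <= r - k)%N ->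
     low_form r k (Y k) (Z (r - 1 - k)%N) = 'X^r * X k)
  (low2 : forall k, (k < r)%N -> (r - k < k)%N ->
     low_form r (r - k) (Z (r - 1 - k)%N) (Y k) = 'X^r * X k)
  (high1 : forall k, (k < r)%N -> (k <= r - k)%N ->
     high_form r k (Z (a - 1 - k)%N) (Y (a - r + k)%N) = X' k)
  (high2 : forall k, (k < r)%N -> (r - k < k)%N ->
     high_form r (r - k) (Y (a - r + k)%N) (Z (a - 1 - k)%N) = X' k).

(** [Y l] has size at most l + [eY l]: its [l] lowest coefficients are killed at 0 and the other
    [eY l] at infinity. For [Z l] the numbers are l + 1 and [eZ l]. *)
Let eY l := (r - last_link l)%N.
Let eZ l := (r - 1 - last_link l)%N.

Definition chain_below (M : int) : Prop :=
  forall l, (l < r)%N ->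
    deg_below F r l (eY l) M (Y l) /\ deg_below F r l.+1 (eZ l) M (Z l).

Lemma chain_low M : chain_below (M + 1) -> forall k, (k < r)%N ->
  (forall x n : nat, (x < k)%N ->
     M + potential r k (eY k) x <= n%:Z -> ((Y k)`_x)`_n = 0) /\
  (forall x n : nat, (x < r - k)%N ->
     M + potential r (r - k) (eZ (r - 1 - k)) x <= n%:Z ->
     ((Z (r - 1 - k)%N)`_x)`_n = 0).
Proof.
move=> HM k kr.
have [HY _] := HM k kr.
have hk : (r - 1 - k < r)%N by lia.
have [_ HZ] := HM _ hk.
have e1 : ((r - 1 - k).+1 = r - k)%N by lia.
rewrite e1 in HZ.
have le1 : (eY k <= r)%N by rewrite leq_subr.
have le2 : (eZ (r - 1 - k) <= r)%N by rewrite /eZ; lia.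
have [h|h] := leqP k (r - k).
  by apply: (low_rows _ _ _ _ _ _ _ _ _ h _ _ _ HY HZ (low1 k kr h)) => //; lia.
have rk : (r - (r - k) = k)%N by lia.
have l2 : low_form r (r - k) (Z (r - 1 - k)%N) (Y k) = 'X^r * X k by exact: low2.
have h1 : (r - k <= r - (r - k))%N by lia.
have HY' : deg_below F r (r - (r - k)) (eY k) (M + 1) (Y k) by rewrite rk.
have := low_rows F r (r - k) _ _ M _ _ _ h1 (leq_subr _ _) le2 le1 HZ HY' l2.
by rewrite rk => -[]; split.
Qed.

(** The last link of the chain is [W l] times u^(a - r + last_link l - l), and it still has size at
    most [a]. *)
Lemma chain_size (W : nat -> {poly {poly F}}) l :
  (forall j, (j < a)%N -> (size (W j) <= a)%N) ->
  (forall j, (r <= j < a)%N -> W j = 'X^r * W (j - r)%N) ->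
  (l < r)%N -> (size (W l) <= l + eY l)%N.
Proof.
move=> sW cW lr; have hk := last_link_lt _ lr.
have hj : (a - r + last_link l < a)%N by lia.
have := sW _ hj; rewrite (chain_link _ cW) // last_linkK //.
have [->|nz] := eqVneq (W l) 0; first by rewrite size_poly0.
have := leq_mod (a - r + last_link l) r; rewrite last_linkK // => h1.
by rewrite size_monicM ?monicXn // size_polyXn /eY; lia.
Qed.

Lemma chain_high M : chain_below (M + 1) -> forall k, (k < r)%N ->
  let l := ((a - r + k) %% r)%N in let m := ((a - 1 - k) %% r)%N in
  (forall x n : nat, (l <= x)%N ->
     M + potential r l (eY l) x <= n%:Z -> ((Y l)`_x)`_n = 0) /\
  (forall x n : nat, (m < x)%N ->
     M + potential r m.+1 (eZ m) x <= n%:Z -> ((Z m)`_x)`_n = 0).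
Proof.
move=> HM k kr l m.
have lr : (l < r)%N by rewrite ltn_pmod.
have mr : (m < r)%N by rewrite ltn_pmod.
have kl : last_link l = k by rewrite mod_last_link.
have km : last_link m = (r - 1 - k)%N.
  rewrite /m (_ : (a - 1 - k = a - r + (r - 1 - k))%N); last by lia.
  by rewrite mod_last_link //; lia.
have [HY _] := HM l lr; have [_ HZ] := HM m mr.
have El : eY l = (r - k)%N by rewrite /eY kl.
have Em : eZ m = k by rewrite /eZ km; lia.
have sl := chain_size Y l sY cY lr; have sm := chain_size Z m sZ cZ mr.
have hl := leq_mod (a - r + k) r; have hm := leq_mod (a - 1 - k) r.
rewrite -/l in hl; rewrite -/m in hm.
have em' : eY m = k.+1 by rewrite /eY km; lia.
have topY : Y (a - r + k)%N = 'X^(a - (l + (r - k))) * Y l.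
  rewrite (chain_link _ cY) -/l; last by clear -kr ra; lia.
  by congr ('X^_ * _); clear -hl kr ra; lia.
have topZ : Z (a - 1 - k)%N = 'X^(a - (m.+1 + k)) * Z m.
  rewrite (chain_link _ cZ) -/m; last by clear -kr ra; lia.
  by congr ('X^_ * _); clear -hm kr ra; lia.
have beyond (y : {poly {poly F}}) (L e D : nat) :
    (size y <= D)%N -> (forall x n : nat, (L <= x < D)%N ->
      M + potential r L e x <= n%:Z -> (y`_x)`_n = 0) ->
    (forall x n : nat, (L <= x)%N ->
      M + potential r L e x <= n%:Z -> (y`_x)`_n = 0).
  move=> sy H x n hx; have [lt|ge] := ltnP x D; first by apply: H; rewrite hx.
  by rewrite [y`_x]nth_default ?coef0 //; apply: leq_trans ge.
suff [h1 h2] : (forall x n : nat, (l <= x < l + (r - k))%N ->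
     M + potential r l (r - k) x <= n%:Z -> ((Y l)`_x)`_n = 0) /\
  (forall x n : nat, (m.+1 <= x < m.+1 + k)%N ->
     M + potential r m.+1 k x <= n%:Z -> ((Z m)`_x)`_n = 0).
  rewrite El Em; split.
    by apply: (beyond _ _ _ (l + (r - k))%N _ h1); rewrite -El.
  by apply: (beyond _ _ _ (m.+1 + k)%N _ h2); rewrite addSnnS -em'.
have sYt : (size (Y (a - r + k)%N) <= a)%N by apply: sY; clear -kr ra; lia.
have sZt : (size (Z (a - 1 - k)%N) <= a)%N by apply: sZ; clear -kr ra; lia.
rewrite El in HY; rewrite Em in HZ.
have [h|h] := leqP k (r - k).
  have k1 : (k <= r)%N by clear -h kr ra lr mr hl hm; lia.
  have k2 : (m.+1 <= r)%N by clear -h kr ra lr mr hl hm; lia.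
  have k3 : (l <= r)%N by clear -h kr ra lr mr hl hm; lia.
  have k4 : (m.+1 + k <= a)%N by clear -h kr ra lr mr hl hm; lia.
  have k5 : (l + (r - k) <= a)%N by clear -h kr ra lr mr hl hm; lia.
  have := high_rows F r k m.+1 l a M _ _ _ _ _ h k1 ra k2 k3 k4 k5 topZ topY sYt
    (sX' k kr) HZ HY (high1 k kr h).
  by move=> [h1 h2]; split.
have rk : (r - (r - k) = k)%N by clear -kr; lia.
have k0 : (r - k <= r - (r - k))%N by clear -h kr ra lr mr hl hm; lia.
have k2 : (l <= r)%N by clear -h kr ra lr mr hl hm; lia.
have k3 : (m.+1 <= r)%N by clear -h kr ra lr mr hl hm; lia.
have k4 : (l + (r - k) <= a)%N by clear -h kr ra lr mr hl hm; lia.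
have k5 : (m.+1 + (r - (r - k)) <= a)%N by clear -h kr ra lr mr hl hm; lia.
have topZ' : Z (a - 1 - k)%N = 'X^(a - (m.+1 + (r - (r - k)))) * Z m by rewrite rk.
have HZ' : deg_below F r m.+1 (r - (r - k)) (M + 1) (Z m) by rewrite rk.
have := high_rows F r (r - k) l m.+1 a M _ _ _ _ _ k0 (leq_subr _ _) ra k2 k3 k4 k5
  topY topZ' sZt (sX' k kr) HY HZ' (high2 k kr h).
by rewrite rk => -[]; split.
Qed.

(** For [Y l], low equation [l] treats the coefficients below u^l and high equation [last_link l]
    the others. For [Z l] the equations are r - 1 - l and r - 1 - [last_link l]. *)
Lemma chain_step M : chain_below (M + 1) -> chain_below M.
Proof.
move=> HM l lr; split=> x n hn.
  have [lt|ge] := ltnP x l.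
    by have [+ _] := chain_low M HM l lr; apply.
  have := chain_high M HM (last_link l) (last_link_lt _ lr).
  by rewrite /= last_linkK // => -[+ _]; apply.
have [lt|ge] := ltnP x l.+1.
  have hk : (r - 1 - l < r)%N by lia.
  have [_ +] := chain_low M HM _ hk.
  have -> : (r - (r - 1 - l) = l.+1)%N by lia.
  have -> : (r - 1 - (r - 1 - l) = l)%N by lia.
  by apply.
have hl := last_link_lt _ lr.
have hk : (r - 1 - last_link l < r)%N by lia.
have := chain_high M HM _ hk.
rewrite /= (_ : a - 1 - (r - 1 - last_link l) = a - r + last_link l)%N; last by lia.
by rewrite last_linkK // => -[_ +]; apply.
Qed.

(** Some bound [M] holds at the outset and [chain_step] lowers it without end, so the first r links
    vanish; the others are multiples of them. *)
Lemma chain_eq0 j : (j < a)%N -> Y j = 0 /\ Z j = 0.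
Proof.
have [M0 HM0] : exists M, chain_below M.
  apply: uniform_bound => [l M M' MM [h1 h2]|l].
    by split; [apply: deg_below_mono h1 | apply: deg_below_mono h2].
  have [M1 h1] := deg_below_exists r l (eY l) (Y l).
  have [M2 h2] := deg_below_exists r l.+1 (eZ l) (Z l).
  exists (Num.max M1 M2).
  by split; [apply: deg_below_mono h1 | apply: deg_below_mono h2]; rewrite le_max lexx ?orbT.
have HM (k : nat) : chain_below (M0 - k%:Z).
  elim: k => [|k IH]; first by rewrite subr0.
  by apply: chain_step; rewrite (_ : _ + 1 = M0 - k%:Z) //; lia.
have Hall M : chain_below M.
  move=> l lr; have [h1 h2] := HM `|M0 - M|%N l lr.
  by split; [apply: deg_below_mono h1 | apply: deg_below_mono h2]; lia.
have base l : (l < r)%N -> Y l = 0 /\ Z l = 0.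
  move=> lr; split.
    by apply: (deg_below_eq0 r l (eY l)) => M; have [] := Hall M l lr.
  by apply: (deg_below_eq0 r l.+1 (eZ l)) => M; have [] := Hall M l lr.
move=> ja; rewrite (chain_link _ cY) // (chain_link _ cZ) //.
have [-> ->] := base (j %% r)%N (ltn_pmod _ r0).
by rewrite !mulr0.
Qed.

End Chain.
End TropicalChain.

(** * Specialisation and linearisation *)

Section Specialization.

Lemma fraction_numden (R : idomainType) (x : {fraction R}) :
  exists d n : R, d != 0 /\ FracField.tofrac d * x = FracField.tofrac n.
Proof.
elim/quotW: x => y; exists (frac y).2, (frac y).1; split.
  exact: denom_ratioP.
rewrite -[LHS]/(FracField.mul _ _); apply/eqP; rewrite !piE.
rewrite FracField.equivfE /FracField.mulf.
have d0 := denom_ratioP y.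
by rewrite !numden_Ratio ?oner_eq0 ?mul1r // mulr1.
Qed.

Lemma common_denominator (R : idomainType) m n (C : 'M[{fraction R}]_(m, n)) :
  exists (d : R) (D : 'M[R]_(m, n)), d != 0 /\
    map_mx (@FracField.tofrac R) D = FracField.tofrac d *: C.
Proof.
have [d [d0 dP]] : exists d : R, d != 0 /\ forall p : 'I_m * 'I_n,
    exists v, FracField.tofrac d * C p.1 p.2 = FracField.tofrac v.
  have [d [d0 dP]] : exists d : R, d != 0 /\
      forall p, p \in enum {: 'I_m * 'I_n} ->
      exists v, FracField.tofrac d * C p.1 p.2 = FracField.tofrac v.
    elim: (enum _) => [|p s [d [d0 dP]]]; first by exists 1; rewrite oner_eq0.
    have [e [v [e0 eP]]] := fraction_numden R (C p.1 p.2).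
    exists (e * d); rewrite mulf_neq0 //; split=> // p'.
    rewrite inE => /orP [/eqP ->|/dP [v' v'P]].
      by exists (d * v); rewrite !tofracM -eP mulrCA mulrA.
    by exists (e * v'); rewrite !tofracM -v'P mulrA.
  by exists d; split=> // p; apply: dP; rewrite mem_enum.
have [D DP] := fin_all_exists dP.
exists d, (\matrix_(i, j) D (i, j)); split=> //.
by apply/matrixP => i j; rewrite !mxE -(DP (i, j)).
Qed.

(** Over the fraction field [M] has a right inverse. Clearing denominators gives M D = d with d
    nonzero, and any nonroot c of [d] preserves a right inverse. *)
Lemma specialize_row_free (F : closedFieldType) m n (M : 'M[{poly F}]_(m, n)) :
  (forall z : 'rV_m, z *m M = 0 -> z = 0) ->
  exists c : F, row_free (map_mx (horner_eval c) M).
Proof.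
move=> inj; pose tf := @FracField.tofrac {poly F}.
have tf_inj : injective tf by move=> x y /eqP; rewrite tofrac_eq => /eqP.
have tf_mx_inj p q : injective (map_mx tf : 'M_(p, q) -> 'M_(p, q)).
  by move=> A B /matrixP E; apply/matrixP => i j; have := E i j; rewrite !mxE => /tf_inj.
have /row_freeP [C MC] : row_free (map_mx tf M).
  apply: inj_row_free => v vM.
  have [d [D [d0 DE]]] := common_denominator _ _ _ v.
  have D0 : D = 0.
    apply: inj; apply: tf_mx_inj.
    by rewrite map_mxM map_mx0 DE -scalemxAl vM scaler0.
  apply/eqP; move/eqP: DE; rewrite D0 map_mx0 eq_sym scaler_eq0 tofrac_eq0.
  by rewrite (negPf d0).
have [d [D [d0 DE]]] := common_denominator _ _ _ C.
have MD : M *m D = d%:M.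
  apply: tf_mx_inj.
  by rewrite map_mxM DE -scalemxAr MC scalemx1 map_scalar_mx.
have /closed_nonrootP [c rc] := d0; exists c.
apply/row_freeP; exists (d.[c]^-1 *: map_mx (horner_eval c) D).
rewrite -scalemxAr -map_mxM MD map_scalar_mx /= /horner_eval.
by rewrite -scalemx1 scalerA mulVf // scale1r.
Qed.

End Specialization.

(** * The matrix of a system *)

Section Linearization.
Variable R : idomainType.
Variables (N a d : nat) (v : nat -> {poly R}) (I J : finType) (T : nat -> J -> I -> R).

Definition sysentry (p : I * 'I_a) (q : J * 'I_(a + d)) : R :=
  \sum_(l < N) T l q.1 p.1 * (if (p.2 <= q.2)%N then (v l)`_(q.2 - p.2) else 0).

Definition sysmx : 'M[R]_(#|{: I * 'I_a}|, #|{: J * 'I_(a + d)}|) :=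
  \matrix_(i, j) sysentry (enum_val i) (enum_val j).

Definition sysvec (z : 'rV[R]_#|{: I * 'I_a}|) (k : I) : {poly R} :=
  \sum_(t < a) z 0 (enum_rank (k, t)) *: 'X^t.

Lemma coef_sysvec z k (t : 'I_a) : (sysvec z k)`_t = z 0 (enum_rank (k, t)).
Proof.
rewrite /sysvec coef_sum (bigD1 t) //= coefZ coefXn eqxx mulr1 big1 ?addr0 //.
by move=> t' ne; rewrite coefZ coefXn eq_sym val_eqE (negPf ne) mulr0.
Qed.

Lemma size_sysvec z k : (size (sysvec z k) <= a)%N.
Proof.
apply: (leq_trans (size_sum _ _ _)); apply/bigmax_leqP => t _.
by apply: (leq_trans (size_scale_leq _ _)); rewrite size_polyXn.
Qed.

Lemma sysvec_onto (x : I -> {poly R}) : (forall k, (size (x k) <= a)%N) ->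
  exists z, forall k, x k = sysvec z k.
Proof.
move=> hx; 
pose c (p : I * 'I_a) := (x p.1)`_p.2.
exists (\row_i c (enum_val i)) => k.
apply/polyP => t; have [lt|ge] := ltnP t a.
  by rewrite (coef_sysvec _ _ (Ordinal lt)) mxE enum_rankK.
by rewrite !nth_default //; apply: leq_trans ge; rewrite ?size_sysvec.
Qed.

Lemma coef_sys_lhs z j (y : 'I_(a + d)) :
  (sys_lhs R N v I J T (sysvec z) j)`_y = (z *m sysmx) 0 (enum_rank (j, y)).
Proof.
rewrite mxE (reindex _ (onW_bij _ (@enum_rank_bij (I * 'I_a)%type))) /=.
have <- : \sum_k \sum_(t < a) z 0 (enum_rank (k, t)) *
     sysmx (enum_rank (k, t)) (enum_rank (j, y))
   = \sum_p z 0 (enum_rank p) * sysmx (enum_rank p) (enum_rank (j, y)).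
  by rewrite pair_bigA; apply: eq_bigr => -[].
rewrite /sys_lhs exchange_big coef_sum; apply: eq_bigr => k _.
transitivity (\sum_(l < N) \sum_(t < a) z 0 (enum_rank (k, t)) *
   (T l j k * if (t <= y)%N then (v l)`_(y - t) else 0)).
  rewrite coef_sum; apply: eq_bigr => l _.
  rewrite /sysvec mulr_sumr scaler_sumr coef_sum; apply: eq_bigr => t _.
  by rewrite -scalerAr !coefZ coefMXn mulrCA ltnNge; case: leqP.
rewrite exchange_big; apply: eq_bigr => t _; rewrite -mulr_sumr; congr (_ * _).
by rewrite mxE !enum_rankK.
Qed.

Lemma size_sys_lhs (x : I -> {poly R}) j : (forall i, (i < N)%N -> (size (v i) <= d.+1)%N) ->
  (forall k, (size (x k) <= a)%N) -> (size (sys_lhs R N v I J T x j) <= a + d)%N.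
Proof.
move=> hv hx; apply: (leq_trans (size_sum _ _ _)); apply/bigmax_leqP => l _.
apply: (leq_trans (size_sum _ _ _)); apply/bigmax_leqP => k _.
apply: (leq_trans (size_scale_leq _ _)); apply: (leq_trans (size_polyMleq _ _)).
have := hv l (ltn_ord l); have := hx k; move: (size _) (size _) => p q; lia.
Qed.

Lemma sys_lhs_eq0 z : (forall i, (i < N)%N -> (size (v i) <= d.+1)%N) ->
  z *m sysmx = 0 <-> forall j, sys_lhs R N v I J T (sysvec z) j = 0.
Proof.
move=> hv; split=> [E j|E].
  apply/polyP => y; rewrite coef0; have [lt|ge] := ltnP y (a + d).
    by rewrite (coef_sys_lhs z j (Ordinal lt)) E mxE.
  rewrite nth_default //; apply: leq_trans ge; apply: size_sys_lhs => // k.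
  exact: size_sysvec.
apply/rowP => w; rewrite -(enum_valK w); case: (enum_val w) => j y.
by rewrite -coef_sys_lhs E coef0 mxE.
Qed.

Lemma inj_sysP : (forall i, (i < N)%N -> (size (v i) <= d.+1)%N) ->
  inj_sys R N a v I J T <-> (forall z : 'rV_(_), z *m sysmx = 0 -> z = 0).
Proof.
move=> hv; split=> [inj z /sys_lhs_eq0 E|inj x hx E k].
  apply/rowP => w; rewrite -(enum_valK w); case: (enum_val w) => k t.
  rewrite -coef_sysvec (inj (sysvec z)) ?coef0 ?mxE //; last exact: E.
  by move=> k'; apply: size_sysvec.
have [z zP] := sysvec_onto x hx; rewrite zP.
suff -> : z = 0.
  by rewrite /sysvec big1 // => t _; rewrite mxE scale0r.
apply: inj; apply/sys_lhs_eq0 => // j; rewrite -[RHS](E j) /sys_lhs.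
by apply: eq_bigr => l _; apply: eq_bigr => k' _; rewrite zP.
Qed.

End Linearization.

Lemma inj_sys_specialize (F : closedFieldType) (N a d : nat)
    (v : nat -> {poly {poly F}}) (I J : finType) (T : nat -> J -> I -> {poly F}) :
  (forall i, (i < N)%N -> (size (v i) <= d.+1)%N) -> inj_sys _ N a v I J T ->
  exists c : F, inj_sys F N a (fun i => map_poly (horner_eval c) (v i)) I J
    (fun i j k => (T i j k).[c]).
Proof.
move=> hv inj.
have /specialize_row_free [c rf] := (inj_sysP _ _ a _ _ _ _ T hv).1 inj.
exists c; apply: (inj_sysP _ _ _ d _ _ _ _ _).2 => [i hi|z E].
  exact: leq_trans (size_poly _ _) (hv i hi).
apply: (row_free_inj rf); rewrite mul0mx -[RHS]E; congr (_ *m _).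
apply/matrixP => i j; rewrite !mxE rmorph_sum; apply: eq_bigr => l _.
rewrite rmorphM /=; congr (_ * _); case: ifP => _; last by rewrite rmorph0.
by rewrite coef_map.
Qed.

(** * The explicit system for three generators *)

Section Sparse.
Variables (R : idomainType) (N : nat) (v : nat -> {poly R}) (I J : finType).
Variable ent : J -> seq (nat * I * R).

Definition sparse (i : nat) (j : J) (k : I) : R :=
  \sum_(e <- ent j | (e.1.1 == i) && (e.1.2 == k)) e.2.

Lemma sparse_lhs (x : I -> {poly R}) j :
  all (fun e => e.1.1 < N)%N (ent j) ->
  sys_lhs R N v I J sparse x j = \sum_(e <- ent j) e.2 *: (v e.1.1 * x e.1.2).
Proof.
move=> /allP hN; rewrite /sys_lhs /sparse.
under eq_bigr => i _ do under eq_bigr => k _ do rewrite scaler_suml big_mkcond.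
under eq_bigr => i _ do rewrite exchange_big.
rewrite exchange_big big_seq [RHS]big_seq; apply: eq_bigr => e /hN he.
rewrite (bigD1 (Ordinal he)) //= (bigD1 e.1.2) //= !eqxx /= big1 ?addr0.
  rewrite big1 ?addr0 // => i ne; rewrite big1 // => k _.
  by rewrite ifF // eq_sym; apply/negbTE; rewrite negb_and -val_eqE in ne *; rewrite ne.
by move=> k ne; rewrite eq_sym (negPf ne).
Qed.

End Sparse.

Section Three.
Variables (F : closedFieldType) (r a : nat).
Hypotheses (r0 : (0 < r)%N) (ra : (r <= a)%N).
Let a0 : (0 < a)%N. Proof. exact: leq_trans ra. Qed.
(** The unknowns are Y_j, Z_j, X_k and X'_k. There are 2 a + 2 r of them for 2 a equations, which is
    the ratio (a + r) / a. *)
Let I := (('I_a + 'I_a) + ('I_r + 'I_r))%type.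
Let J := (('I_(a - r) + 'I_(a - r)) + ('I_r + 'I_r))%type.
Let toI (n : nat) : 'I_a := insubd (Ordinal a0) n.
Let y n : I := inl (inl (toI n)).
Let z n : I := inl (inr (toI n)).

Definition three_basis (i : nat) : {poly {poly F}} :=
  match i with 0%N => 1 | 1%N => tpoly F r | _ => 'X^r end.

Definition low_entries o p q k : seq (nat * I * {poly F}) :=
  [:: (0%N, p, 'X^(tweight r o));
      (1%N, q, 'X^((4 * (r - o) + 1) * (2 * (r - o)))); (2%N, k, -1)].

Definition high_entries o p q k : seq (nat * I * {poly F}) :=
  [:: (2%N, p, 'X^(4 * (r - o) * (r + o) + 8 * o * (r - o)));
      (1%N, q, 'X^(2 * (r - o))); (0%N, k, -1)].

(** X_k and X'_k are slack unknowns: multiplied by u^r, X_k says that a low form is 0 modulo u^r;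
    multiplied by 1, X'_k says that a high form has degree below [a]. The first two families of
    equations link the chains. *)
Definition three_entries (j : J) : seq (nat * I * {poly F}) :=
  match j with
  | inl (inl j) => [:: (0%N, y (r + j), 1); (2%N, y j, -1)]
  | inl (inr j) => [:: (0%N, z (r + j), 1); (2%N, z j, -1)]
  | inr (inl k) =>
      if (k <= r - k)%N then low_entries k (y k) (z (r - 1 - k)) (inr (inl k))
      else low_entries (r - k) (z (r - 1 - k)) (y k) (inr (inl k))
  | inr (inr k) =>
      if (k <= r - k)%N
      then high_entries k (z (a - 1 - k)) (y (a - r + k)) (inr (inr k))
      else high_entries (r - k) (y (a - r + k)) (z (a - 1 - k)) (inr (inr k))
  end.

Lemma three_inj : inj_sys _ 3 a three_basis I J (sparse _ _ _ three_entries).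
Proof.
move=> x hx E.
have {}E j : \sum_(e <- three_entries j) e.2 *: (three_basis e.1.1 * x e.1.2) = 0.
  rewrite -[RHS](E j) sparse_lhs //.
  by case: j => [[j|j]|[k|k]] //=; case: ifP.
pose toR (n : nat) : 'I_r := insubd (Ordinal r0) n.
have toRK (k : 'I_r) : toR k = k by apply: val_inj; rewrite val_insubd ltn_ord.
have toIK (k : 'I_a) : toI k = k by apply: val_inj; rewrite val_insubd ltn_ord.
pose Y n := x (y n); pose Z n := x (z n).
pose X n := x (inr (inl (toR n))); pose X' n := x (inr (inr (toR n))).
have sub2 (p q : {poly {poly F}}) : 1 *: (1 * p) + ((-1) *: q + 0) = 0 -> p = q.
  by rewrite scale1r mul1r scaleN1r addr0 => /eqP; rewrite subr_eq0 => /eqP.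
have shift (W : nat -> I) : (forall j : 'I_(a - r),
      1 *: (1 * x (W (r + j)%N)) + ((-1) *: ('X^r * x (W j)) + 0) = 0) ->
    forall j, (r <= j < a)%N -> x (W j) = 'X^r * x (W (j - r)%N).
  move=> H j /andP [rj ja]; have hj : (j - r < a - r)%N by lia.
  by have /sub2 := H (Ordinal hj); rewrite /= subnKC.
have cY : forall j, (r <= j < a)%N -> Y j = 'X^r * Y (j - r)%N.
  by apply: (shift y) => j; rewrite -[RHS](E (inl (inl j))) /= !big_cons big_nil.
have cZ : forall j, (r <= j < a)%N -> Z j = 'X^r * Z (j - r)%N.
  by apply: (shift z) => j; rewrite -[RHS](E (inl (inr j))) /= !big_cons big_nil.
have lowE o p q k : \sum_(e <- low_entries o p q k)
    e.2 *: (three_basis e.1.1 * x e.1.2) = 0 ->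
    low_form F r o (x p) (x q) = 'X^r * x k.
  rewrite !big_cons big_nil /= mul1r scaleN1r addr0 addrA => /eqP.
  by rewrite subr_eq0 => /eqP.
have highE o p q k : \sum_(e <- high_entries o p q k)
    e.2 *: (three_basis e.1.1 * x e.1.2) = 0 ->
    high_form F r o (x p) (x q) = x k.
  rewrite !big_cons big_nil /= mul1r scaleN1r addr0 addrA => /eqP.
  by rewrite subr_eq0 => /eqP.
have low1 k : (k < r)%N -> (k <= r - k)%N ->
     low_form F r k (Y k) (Z (r - 1 - k)%N) = 'X^r * X k.
  move=> kr h; have := E (inr (inl (Ordinal kr))); rewrite /= h => /lowE.
  by rewrite -(toRK (Ordinal kr)).
have low2 k : (k < r)%N -> (r - k < k)%N ->
     low_form F r (r - k) (Z (r - 1 - k)%N) (Y k) = 'X^r * X k.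
  move=> kr h; have := E (inr (inl (Ordinal kr))); rewrite /= leqNgt h => /lowE.
  by rewrite -(toRK (Ordinal kr)).
have high1 k : (k < r)%N -> (k <= r - k)%N ->
     high_form F r k (Z (a - 1 - k)%N) (Y (a - r + k)%N) = X' k.
  move=> kr h; have := E (inr (inr (Ordinal kr))); rewrite /= h => /highE.
  by rewrite -(toRK (Ordinal kr)).
have high2 k : (k < r)%N -> (r - k < k)%N ->
     high_form F r (r - k) (Y (a - r + k)%N) (Z (a - 1 - k)%N) = X' k.
  move=> kr h; have := E (inr (inr (Ordinal kr))); rewrite /= leqNgt h => /highE.
  by rewrite -(toRK (Ordinal kr)).
have YZ0 := chain_eq0 F r a r0 ra Y Z X X' (fun j _ => hx _) (fun j _ => hx _)
  (fun j _ => hx _) cY cZ low1 low2 high1 high2.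
have Y0 j : (j < a)%N -> Y j = 0 by case/YZ0.
have Z0 j : (j < a)%N -> Z j = 0 by case/YZ0.
have lowf0 o : low_form F r o 0 0 = 0 by rewrite /low_form mulr0 !scaler0 addr0.
have highf0 o : high_form F r o 0 0 = 0 by rewrite /high_form !mulr0 !scaler0 addr0.
case=> [[j|j]|[k|k]].
- by rewrite -(toIK j) -/(y j) -/(Y j) Y0.
- by rewrite -(toIK j) -/(z j) -/(Z j) Z0.
- rewrite -(toRK k) -/(X k); have kr := ltn_ord k.
  have Yk : Y k = 0 by apply: Y0; lia.
  have Zk : Z (r - 1 - k)%N = 0 by apply: Z0; lia.
  have : 'X^r * X k = 0.
    have [h|h] := leqP k (r - k); first by rewrite -low1 // Yk Zk lowf0.
    by rewrite -low2 // Yk Zk lowf0.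
  by move/eqP; rewrite mulf_eq0 expf_eq0 polyX_eq0 andbF => /eqP.
rewrite -(toRK k) -/(X' k); have kr := ltn_ord k.
have Yk : Y (a - r + k)%N = 0 by apply: Y0; lia.
have Zk : Z (a - 1 - k)%N = 0 by apply: Z0; lia.
have [h|h] := leqP k (r - k); first by rewrite -high1 // Yk Zk highf0.
by rewrite -high2 // Yk Zk highf0.
Qed.

Lemma certified_three : certified F 3 a r.
Proof.
have st i : (i < 3)%N -> (size (three_basis i) <= r.+1)%N.
  by case: i => [|[|[|]]] // _; rewrite /= ?size_poly1 ?size_poly ?size_polyXn.
have [c inj] := inj_sys_specialize F 3 a r three_basis _ _ _ st three_inj.
exists (fun i => map_poly (horner_eval c) (three_basis i)); split.
- by rewrite /= rmorph1.
- by rewrite /= map_polyXn size_polyXn.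
- by move=> i hi; apply: leq_trans (size_poly _ _) (st i hi).
exists I, J, (fun i j k => (sparse _ _ _ three_entries i j k).[c]).
split=> //; rewrite !card_sum !card_ord; first by lia.
by nia.
Qed.

End Three.

(** * The admissible ratios *)

Section Range.
Variable F : closedFieldType.
Implicit Types N a b d : nat.

(** Ratios below N - 1, by induction on N: below N - 2 a generator is added at the same ratio,
    otherwise 1 is subtracted from the ratio. *)
Lemma certified_below n a d : (d < n.+1 * a)%N -> certified F n.+3 a d.
Proof.
elim: n d => [|n IH] d hd.
  rewrite mul1n in hd; have [->|d0] := posnP d; first exact: certified_const.
  by apply: certified_three => //; apply: ltnW.
have [lt|ge] := ltnP d (n.+1 * a).
  by apply: certified_widen => //; apply: IH.
have ad : (a <= d)%N by rewrite (leq_trans _ ge) // mulSn leq_addr.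
rewrite -(subnK ad); apply: certified_add => //; apply: IH.
by rewrite mulSn in hd; lia.
Qed.

(* The quadratic form a^2 + b^2 - N a b is invariant under the reflection
   (a, b) |-> (N a - b, a), and is negative exactly when b / a lies strictly
   between the two roots of x^2 - N x + 1. *)
Lemma certified_quadratic n a b : (0 < a)%N -> (a <= b)%N ->
  (a ^ 2 + b ^ 2 < n.+2 * a * b)%N -> certified F n.+2 a (b - a).
Proof.
elim/ltn_ind: a b => a IH b a0 ab quad.
have [lt|ge] := ltnP b (n.+1 * a).
  case: n IH quad lt => [|n] IH quad lt; first by lia.
  by apply: certified_below; move: lt; rewrite mulSn; lia.
have bN : (b < n.+2 * a)%N.
  by rewrite -(ltn_pmul2r (leq_trans a0 ab)); nia.
have -> : (b - a = n * a + (b - n.+1 * a))%N by rewrite mulSn in ge *; lia.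
have ra : (b - n.+1 * a < a)%N by rewrite mulSn in bN; lia.
apply: certified_reflect => //.
have [->|r0] := posnP (b - n.+1 * a); first exact: certified_const.
(* With r = b - (N - 1) a one has a - r = N a - b, so the induction hypothesis is applied to the
   pair (N a - b, a). *)
rewrite -{2}(subKn (ltnW ra)); apply: IH; try lia.
Qed.

Lemma theta_iter_ge1 N i : (2 <= N)%N -> 1 <= theta_iter N i.
Proof.
move=> N2; elim: i => [|i IH] /=; first by rewrite ler1n ltnW.
have : (theta_iter N i)^-1 <= 1 by rewrite invf_le1 // (lt_le_trans ltr01).
have : (2 : rat) <= N%:R by rewrite ler_nat.
by lra.
Qed.

(** These ratios exceed psi_N, where the quadratic form is positive. Each reflection lowers [i] by
    one, and the descent ends at ratio N. *)
Lemma certified_theta n i a b : (0 < a)%N -> (a <= b)%N ->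
  (b%:R / a%:R : rat) = theta_iter n.+2 i -> certified F n.+2 a (b - a).
Proof.
elim: i a b => [|i IH] a b a0 ab.
  have a1 : (a%:R : rat) != 0 by rewrite pnatr_eq0 -lt0n.
  move=> /= /(canRL (divfK a1)) /eqP; rewrite -natrM eqr_nat => /eqP ->.
  by rewrite mulSn addKn; apply: (certified_max F n.+2 a).
move=> /= E; have th1 := theta_iter_ge1 n.+2 i isT.
have aQ : (0 : rat) < a%:R by rewrite ltr0n.
have thQ : 0 < theta_iter n.+2 i by apply: lt_le_trans th1.
have Eb : (b%:R : rat) = n.+2%:R * a%:R - a%:R / theta_iter n.+2 i.
  by rewrite [a%:R / _]mulrC -mulrBl -E mulfVK // gt_eqF.
have ath : (a%:R / theta_iter n.+2 i : rat) <= a%:R.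
  by rewrite ler_pdivrMr // ler_peMr // ltW.
have ath0 : (0 : rat) < a%:R / theta_iter n.+2 i by rewrite divr_gt0.
have bN : (b < n.+2 * a)%N by rewrite -(ltr_nat rat) natrM Eb; lra.
have ge : (n.+1 * a <= b)%N.
  by rewrite -(ler_nat rat) natrM Eb -[n.+2%:R]natr1 mulrDl mul1r; lra.
have -> : (b - a = n * a + (b - n.+1 * a))%N by rewrite mulSn in ge *; lia.
have ra : (b - n.+1 * a < a)%N by rewrite mulSn in bN; lia.
apply: certified_reflect => //.
rewrite -{2}(subKn (ltnW ra)); apply: IH; try lia.
have e : (a - (b - n.+1 * a) + b = n.+2 * a)%N by rewrite mulSn in bN *; lia.
have {}e : ((a - (b - n.+1 * a))%:R : rat) = a%:R / theta_iter n.+2 i.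
  have := congr1 (fun m : nat => m%:R : rat) e; rewrite natrD natrM Eb; lra.
by rewrite e invf_div mulrA mulrC mulrA mulVf ?mul1r // gt_eqF.
Qed.

Lemma psi_quadratic N (q : rat) : (2 <= N)%N -> 1 < q ->
  (ratr q : algC) < psiN N -> q ^+ 2 + 1 < N%:R * q.
Proof.
move=> N2 q1; set y : algC := ratr q; rewrite /psiN; set s := sqrtC _.
have N2' : (2 : algC) <= N%:R by rewrite (ler_nat _ 2).
have y1 : 1 < y by rewrite -(ltr_rat algC) rmorph1 in q1.
have s2 : s ^+ 2 = N%:R ^+ 2 - 4 by rewrite sqrtCK.
have NN : (0 : algC) <= N%:R ^+ 2 - 4.
  rewrite subr_ge0 (_ : 4 = 2 ^+ 2) ?lerXn2r ?nnegrE ?ler0n //.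
  by rewrite -natrX.
have s0 : 0 <= s by rewrite sqrtC_ge0.
rewrite ltr_pdivlMr ?ltr0n // => ys.
(* This puts the smaller root (N - s) / 2 at or below 1, so 1 < q already places q above it. *)
have ns : N%:R - 2 <= s.
  rewrite -(@ler_pXn2r _ 2) ?nnegrE ?subr_ge0 // s2 -subr_ge0.
  have -> : N%:R ^+ 2 - 4 - (N%:R - 2) ^+ 2 = 4 * (N%:R - 2) :> algC by ring.
  by rewrite mulr_ge0 ?subr_ge0 ?ler0n.
have yr : y * 2 - N%:R \is Num.real.
  have y_real : y \is Num.real by apply: gtr0_real; apply: lt_trans y1.
  by apply: realB; [apply: realM => //; apply: realn | apply: realn].
have : `|y * 2 - N%:R| < s.
  rewrite real_ltr_norml //; apply/andP; split; last by rewrite ltrBlDl.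
  rewrite ltrNl opprB; apply: lt_le_trans ns.
  by rewrite ltrD2l ltrN2 -[X in X < _]mul1r ltr_pM2r ?ltr0n.
move=> h; have : `|y * 2 - N%:R| ^+ 2 < s ^+ 2 by rewrite ltrXn2r.
rewrite real_normK // s2 -subr_gt0.
have -> : N%:R ^+ 2 - 4 - (y * 2 - N%:R) ^+ 2 = 4 * (N%:R * y - (y ^+ 2 + 1)) by ring.
rewrite pmulr_rgt0 ?ltr0n // subr_gt0.
have -> : N%:R * y = ratr (N%:R * q) by rewrite rmorphM /= ratr_nat.
have -> : y ^+ 2 + 1 = ratr (q ^+ 2 + 1) by rewrite rmorphD rmorphXn /= rmorph1.
by rewrite ltr_rat.
Qed.

Lemma certified_inPsi N a b : (2 <= N)%N -> (0 < a)%N -> (a < b)%N ->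
  inPsi N (b%:R / a%:R) -> certified F N a (b - a).
Proof.
case: N => [|[|n]] // _ a0 ab [[q1 qpsi]|[i qi]]; last first.
  by apply: certified_theta qi => //; apply: ltnW.
have := psi_quadratic n.+2 _ isT q1 qpsi.
have aQ : (0 : rat) < a%:R by rewrite ltr0n.
rewrite -(ltr_pM2r (exprn_gt0 2 aQ)) mulrDl mul1r -exprMn mulfVK ?gt_eqF //.
have -> : n.+2%:R * (b%:R / a%:R) * a%:R ^+ 2 = n.+2%:R * a%:R * b%:R :> rat.
  by field; rewrite gt_eqF.
rewrite -!natrX -!natrM -natrD ltr_nat => h.
by apply: certified_quadratic => //; [apply: ltnW | rewrite addnC].
Qed.

End Range.

(** * From certificates to a generic subspace *)

Section PolynomialFunctions.
Variable F : fieldType.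

(** [mxpolyfun] speaks of functions up to conversion; this is its closure under pointwise
    equality. *)
Definition is_mxpolyfun m n (f : 'M[F]_(m, n) -> F) : Prop :=
  exists2 g, mxpolyfun g & f =1 g.

Lemma is_mxpolyfun_const m n c : is_mxpolyfun m n (fun=> c).
Proof. by eexists; first exact: pf_const. Qed.

Lemma is_mxpolyfun_coord m n i j : is_mxpolyfun m n (fun A => A i j).
Proof. by eexists; first exact: pf_coord. Qed.

Lemma is_mxpolyfun_mul m n f g : is_mxpolyfun m n f -> is_mxpolyfun m n g ->
  is_mxpolyfun m n (fun A => f A * g A).
Proof.
move=> [f' pf ef] [g' pg eg]; exists (fun A => f' A * g' A); first exact: pf_mul.
by move=> A; rewrite ef eg.
Qed.

Lemma is_mxpolyfun_sum m n (I : Type) (s : seq I) (f : I -> 'M[F]_(m, n) -> F) :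
  (forall i, is_mxpolyfun m n (f i)) -> is_mxpolyfun m n (fun A => \sum_(i <- s) f i A).
Proof.
move=> pf; elim: s => [|i s [g' pg eg]].
  by exists (fun=> 0); [exact: pf_const | move=> A; rewrite big_nil].
have [f' pf' ef] := pf i; exists (fun A => f' A + g' A); first exact: pf_add.
by move=> A; rewrite big_cons ef eg.
Qed.

Lemma is_mxpolyfun_prod m n (I : Type) (s : seq I) (f : I -> 'M[F]_(m, n) -> F) :
  (forall i, is_mxpolyfun m n (f i)) -> is_mxpolyfun m n (fun A => \prod_(i <- s) f i A).
Proof.
move=> pf; elim: s => [|i s IH].
  by exists (fun=> 1); [exact: pf_const | move=> A; rewrite big_nil].
have [h ph eh] := is_mxpolyfun_mul _ _ _ _ (pf i) IH.
by exists h => // A; rewrite big_cons eh.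
Qed.

Lemma is_mxpolyfun_det m n p (B : 'M[F]_(m, n) -> 'M[F]_p) :
  (forall i j, is_mxpolyfun m n (fun A => B A i j)) ->
  is_mxpolyfun m n (fun A => \det (B A)).
Proof.
move=> pB; apply: is_mxpolyfun_sum => s; apply: is_mxpolyfun_mul.
  exact: is_mxpolyfun_const.
by apply: is_mxpolyfun_prod => i; apply: pB.
Qed.

Lemma is_mxpolyfun_mulmxr m n p q r (B : 'M[F]_(m, n) -> 'M[F]_(p, q))
    (C : 'M[F]_(q, r)) : (forall i j, is_mxpolyfun m n (fun A => B A i j)) ->
  forall i j, is_mxpolyfun m n (fun A => (B A *m C) i j).
Proof.
move=> pB i j.
have [g pg eg] : is_mxpolyfun m n (fun A => \sum_k B A i k * C k j).
  apply: is_mxpolyfun_sum => k; apply: is_mxpolyfun_mul => //.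
  exact: is_mxpolyfun_const.
by exists g => // A; rewrite mxE eg.
Qed.

Lemma mxpolyfun_line m n (f : 'M[F]_(m, n) -> F) (A B : 'M[F]_(m, n)) :
  mxpolyfun f -> exists p : {poly F}, forall t, f (A + t *: B) = p.[t].
Proof.
elim=> [c|i j|g h _ [p pE] _ [q qE]|g h _ [p pE] _ [q qE]].
- by exists c%:P => t; rewrite hornerC.
- exists ((A i j)%:P + B i j *: 'X) => t.
  by rewrite !mxE !hornerE mulrC.
- by exists (p + q) => t; rewrite hornerD pE qE.
- by exists (p * q) => t; rewrite hornerM pE qE.
Qed.

End PolynomialFunctions.

(** On the line through [A] and [B] both functions become nonzero polynomials in one variable, whose
    product has a nonroot. *)
Lemma mxpolyfun_common_nonroot (F : closedFieldType) m n (f g : 'M[F]_(m, n) -> F) A B :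
  mxpolyfun f -> mxpolyfun g -> f A != 0 -> g B != 0 ->
  exists C, f C != 0 /\ g C != 0.
Proof.
move=> pf pg fA gB.
have [p pE] := mxpolyfun_line F m n f A (B - A) pf.
have [q qE] := mxpolyfun_line F m n g A (B - A) pg.
have p0 : p != 0.
  by apply: contraNneq fA => p0; have := pE 0; rewrite scale0r addr0 p0 horner0 => ->.
have q0 : q != 0.
  apply: contraNneq gB => q0; have := qE 1.
  by rewrite scale1r addrC subrK q0 horner0 => ->.
have /closed_nonrootP [t] : p * q != 0 by rewrite mulf_neq0.
rewrite rootM negb_or => /andP [pt qt].
by exists (A + t *: (B - A)); rewrite pE qE.
Qed.

(** * Filling ratios from an injective system *)

Section Filling.
Variable F : fieldType.

Lemma coefmx_row n (s : seq {poly F}) (i : 'I_(size s)) :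
  row i (coefmx n s) = poly_rV s`_i.
Proof. by apply/rowP => j; rewrite !mxE. Qed.

Lemma mem_coefmx n (s : seq {poly F}) f :
  f \in s -> (poly_rV f <= coefmx n s)%MS.
Proof.
move=> fs; have hi : (index f s < size s)%N by rewrite index_mem.
by rewrite -(nth_index 0 fs) -(coefmx_row n s (Ordinal hi)) row_sub.
Qed.

Lemma coefmx_sub n (s : seq {poly F}) (x : 'rV_n) :
  all (fun f : {poly F} => size f <= n)%N s -> (x <= coefmx n s)%MS ->
  exists u : 'I_(size s) -> F, rVpoly x = \sum_i u i *: s`_i.
Proof.
move=> /all_nthP hs /submxP [u ->]; exists (fun i => u 0 i).
rewrite mulmx_sum_row linear_sum; apply: eq_bigr => i _.
by rewrite linearZ /= coefmx_row poly_rV_K ?hs.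
Qed.

(** The system maps W^I to (V.W)^J. If the source had the larger dimension, a nonzero kernel vector
    would contradict injectivity. *)
Lemma inj_sys_filling (N a b : nat) (v : nat -> {poly F}) (I J : finType)
    (T : nat -> J -> I -> F) (vs ws : seq {poly F}) :
  inj_sys F N a v I J T -> (a <= b)%N ->
  (forall i, (i < N)%N -> v i \in vs) ->
  all (fun f : {poly F} => size f <= b - a + 1)%N vs ->
  all (fun f : {poly F} => size f <= a)%N ws ->
  (#|I| * dimspan b ws <= #|J| * dimspan b (prodspan vs ws))%N.
Proof.
move=> inj ab vin svs sws.
set ps := prodspan vs ws.
pose W := row_base (coefmx b ws); pose U := row_base (coefmx b ps).
rewrite leqNgt; apply/negP => lt.
have Wu m : exists u : 'I_(size ws) -> F, rVpoly (row m W) = \sum_i u i *: ws`_i.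
  apply: coefmx_sub.
    by apply/allP => f /(allP sws) h; apply: leq_trans ab.
  by rewrite (submx_trans (row_sub _ _)) // eq_row_base.
have sW m : (size (rVpoly (row m W)) <= a)%N.
  have [u ->] := Wu m; apply: (leq_trans (size_sum _ _ _)); apply/bigmax_leqP => i _.
  by apply: (leq_trans (size_scale_leq _ _)); apply: (allP sws); apply: mem_nth.
have sv l m : (l < N)%N -> (size (v l * rVpoly (row m W))%R <= b)%N.
  move=> hl; apply: (leq_trans (size_polyMleq _ _)).
  have := sW m; have := allP svs _ (vin l hl); move: (size _) (size _) => p q; lia.
have vW l m : (l < N)%N -> (poly_rV (v l * rVpoly (row m W)) <= U)%MS.
  move=> hl; have [u ->] := Wu m.
  rewrite mulr_sumr linear_sum eq_row_base; apply: summx_sub => i _.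
  rewrite -scalerAr linearZ scalemx_sub //; apply: mem_coefmx.
  by apply/allpairsP; exists (v l, ws`_i); rewrite /= vin ?mem_nth.
have Dex (p : 'I_N * 'I_(dimspan b ws)) : exists D : 'rV_(dimspan b ps),
    v p.1 * rVpoly (row p.2 W) = \sum_q D 0 q *: rVpoly (row q U).
  have /submxP [D DE] := vW p.1 p.2 (ltn_ord _); exists D.
  rewrite -[LHS](@poly_rV_K _ b) ?sv //.
  by rewrite DE mulmx_sum_row linear_sum; apply: eq_bigr => q _; rewrite linearZ.
have [D DE] := fin_all_exists Dex.
(* The matrix of that map in the bases [W] and [U]; [D] holds the coordinates of the products v_l
   w_m. *)
pose S (q : J * 'I_(dimspan b ps)) (p : I * 'I_(dimspan b ws)) : F :=
  \sum_(l < N) T l q.1 p.1 * D (l, p.2) 0 q.2.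
have [k [K [cK SK [L LK]]]] := kernel_family F _ _ S.
have k0 : (0 < k)%N by rewrite !card_prod !card_ord in cK; lia.
pose o := Ordinal k0.
pose x i : {poly F} := \sum_m K (i, m) o *: rVpoly (row m W).
have x0 : forall i, x i = 0.
  apply: inj => [i|j].
    apply: (leq_trans (size_sum _ _ _)); apply/bigmax_leqP => m _.
    exact: leq_trans (size_scale_leq _ _) (sW m).
  transitivity (\sum_q (\sum_p S (j, q) p * K p o) *: rVpoly (row q U)); last first.
    by rewrite big1 // => q _; rewrite SK scale0r.
  transitivity (\sum_(l < N) \sum_p \sum_q
      (T l j p.1 * D (l, p.2) 0 q * K p o) *: rVpoly (row q U)).
    apply: eq_bigr => l _.
    transitivity (\sum_i \sum_m \sum_q
      (T l j i * D (l, m) 0 q * K (i, m) o) *: rVpoly (row q U)); last first.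
      by rewrite pair_bigA; apply: eq_bigr => -[].
    apply: eq_bigr => i _; rewrite /x mulr_sumr scaler_sumr; apply: eq_bigr => m _.
    rewrite -scalerAr (DE (l, m)) /= !scaler_sumr; apply: eq_bigr => q _.
    by rewrite !scalerA mulrAC.
  under [RHS]eq_bigr => q _ do rewrite scaler_suml.
  rewrite exchange_big [RHS]exchange_big; apply: eq_bigr => p _.
  rewrite exchange_big; apply: eq_bigr => q _.
  by rewrite /S mulr_suml scaler_suml.
have Wfree : row_free W by rewrite row_base_free.
have K0 i m : K (i, m) o = 0.
  have /(congr1 (@poly_rV _ b)) := x0 i.
  rewrite /x linear_sum linear0.
  under eq_bigr => m' _ do rewrite linearZ /= rVpolyK.
  pose z : 'rV_(dimspan b ws) := \row_m' K (i, m') o => E.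
  have zW : z *m W = 0.
    by rewrite mulmx_sum_row -[RHS]E; apply: eq_bigr => m' _; rewrite mxE.
  have z0 : z = 0 by apply: (row_free_inj Wfree); rewrite zW mul0mx.
  by have := congr1 (fun y : 'rV_ _ => y 0 m) z0; rewrite !mxE.
have := LK o o; rewrite eqxx big1 => [/esym/eqP|[i m] _]; last by rewrite K0 mulr0.
by rewrite oner_eq0.
Qed.

End Filling.

(** * The open condition on V *)

Section Generic.
Variables (F : fieldType) (N d : nat).

Definition rowpoly (A : 'M[F]_(N, d.+1)) (i : nat) : {poly F} :=
  if insub i is Some k then \sum_(j < d.+1) A k j *: 'X^j else 0.

Lemma rowpolyE A (i : 'I_N) : rowpoly A i = \sum_(j < d.+1) A i j *: 'X^j.
Proof. by rewrite /rowpoly valK. Qed.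

Lemma coef_rowpoly A (i : 'I_N) m :
  (rowpoly A i)`_m = if (m < d.+1)%N then A i (inord m) else 0.
Proof.
have -> : rowpoly A i = \poly_(j < d.+1) A i (inord j).
  by rewrite rowpolyE poly_def; apply: eq_bigr => j _; rewrite inord_val.
by rewrite coef_poly.
Qed.

Lemma size_rowpoly A i : (size (rowpoly A i) <= d.+1)%N.
Proof.
rewrite /rowpoly; case: insub => [k|]; last by rewrite size_poly0.
apply: (leq_trans (size_sum _ _ _)); apply/bigmax_leqP => j _.
by apply: (leq_trans (size_scale_leq _ _)); rewrite size_polyXn.
Qed.

Lemma rowpoly_onto (v : nat -> {poly F}) :
  (forall i, (i < N)%N -> (size (v i) <= d.+1)%N) ->
  exists A, forall i, (i < N)%N -> rowpoly A i = v i.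
Proof.
move=> hv; exists (\matrix_(i, j) (v i)`_j) => i hi.
apply/polyP => m; rewrite (coef_rowpoly _ (Ordinal hi)).
case: ltnP => hm; first by rewrite mxE inordK.
by rewrite nth_default //; apply: leq_trans hm; apply: hv.
Qed.

Lemma sysmx_polyfun a (I J : finType) (T : nat -> J -> I -> F) p q :
  is_mxpolyfun F N d.+1 (fun A => sysmx F N a d (rowpoly A) I J T p q).
Proof.
have [g pg eg] : is_mxpolyfun F N d.+1
    (fun A => sysentry F N a d (rowpoly A) I J T (enum_val p) (enum_val q)).
  apply: is_mxpolyfun_sum => l; apply: is_mxpolyfun_mul.
    exact: is_mxpolyfun_const.
  case: (_ <= _)%N; last exact: is_mxpolyfun_const.
  move: (_ - _)%N => m; have [h|h] := boolP (m < d.+1)%N.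
    eexists; first exact: (@pf_coord F N d.+1 l (inord m)).
    by move=> A; rewrite coef_rowpoly h.
  eexists; first exact: (@pf_const F N d.+1 0).
  by move=> A; rewrite coef_rowpoly (negPf h).
by exists g => // A; rewrite mxE eg.
Qed.

End Generic.

(** V is the row space of [A]. The open set in the Grassmannian is the image of the locus P A != 0
    among matrices of rank N, and the filling ratio depends on [A] only through V. *)
Theorem mainTheorem4 (F : closedFieldType) (HF : [pchar F] =i pred0)
  (N a b : nat) (HN : (2 <= N)%N) (Ha : (0 < a)%N) (Hab : (a < b)%N)
  (HNba : (N <= b - a + 1)%N) (Hpsi : inPsi N (b%:R / a%:R)) :
  exists P : 'M[F]_(N, (b - a).+1) -> F,
    mxpolyfun P /\
    (exists A0 : 'M[F]_(N, (b - a).+1), \rank A0 = N /\ P A0 != 0) /\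
    (forall A : 'M[F]_(N, (b - a).+1), \rank A = N -> P A != 0 ->
       forall ws : seq {poly F},
         all (fun w : {poly F} => (size w <= a)%N) ws ->
         (0 < dimspan b ws)%N ->
         b%:R / a%:R <= fillratio b (rowpolys A) ws).
Proof.
have [v [_ _ sv [I [J [T [J0 card_le inj]]]]]] := certified_inPsi F N a b HN Ha Hab Hpsi.
set d := (b - a)%N in sv card_le HNba *.
have [A1 A1v] := rowpoly_onto F N d v sv.
pose B (A : 'M[F]_(N, d.+1)) := sysmx F N a d (rowpoly F N d A) I J T.
have inj1 : inj_sys F N a (rowpoly F N d A1) I J T.
  move=> x hx E; apply: inj => // j; rewrite -[RHS](E j) /sys_lhs.
  by apply: eq_bigr => i _; apply: eq_bigr => k _; rewrite A1v.
have /row_freeP [C BC] : row_free (B A1).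
  apply: inj_row_free; apply: (inj_sysP F N a d _ I J T _).1 => // i _.
  exact: size_rowpoly.
(* [C] is a right inverse of the certified matrix, so this determinant is 1 at [A1], and wherever it
   is nonzero the system is injective. *)
have [P polyP PE] : is_mxpolyfun F N d.+1 (fun A => \det (B A *m C)).
  by apply: is_mxpolyfun_det; apply: is_mxpolyfun_mulmxr; apply: sysmx_polyfun.
exists P; split=> //; split.
  pose E : 'M[F]_(d.+1, N) := pid_mx N.
  have [Q polyQ QE] : is_mxpolyfun F N d.+1 (fun A => \det (A *m E)).
    apply: is_mxpolyfun_det; apply: (is_mxpolyfun_mulmxr _ _ _ _ _ _ id).
    exact: is_mxpolyfun_coord.
  (* The certified generators may be dependent, so rank N is obtained separately: [Q] is the minor
     on the first N columns, which exist because N <= b - a + 1. *)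
  have [||A0 [P0 Q0]] := mxpolyfun_common_nonroot F N d.+1 P Q A1 (pid_mx N) polyP polyQ.
  - by rewrite -PE BC det1 oner_eq0.
  - rewrite -QE mul_pid_mx minnn (minn_idPr _) ?pid_mx_1 ?det1 ?oner_eq0 //.
    by rewrite -addn1.
  exists A0; split=> //; apply/eqP; rewrite eqn_leq rank_leq_row.
  have /mxrank_unit rE : A0 *m E \in unitmx by rewrite unitmxE unitfE QE.
  by rewrite -{1}rE mxrankM_maxl.
move=> A _ PA ws sws w0.
have injA : inj_sys F N a (rowpoly F N d A) I J T.
  apply: (inj_sysP F N a d _ I J T _).2 => [i _|z zB]; first exact: size_rowpoly.
  have BCu : B A *m C \in unitmx by rewrite unitmxE unitfE PE.
  by rewrite -[z](mulmxK BCu) mulmxA zB !mul0mx.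
have le := inj_sys_filling F N a b _ I J T (rowpolys A) ws injA (ltnW Hab).
have {}le : (#|I| * dimspan b ws <= #|J| * dimspan b (prodspan (rowpolys A) ws))%N.
  apply: le => //.
    move=> i hi; apply/mapP; exists (Ordinal hi); first by rewrite mem_enum.
    exact: (rowpolyE F N d A (Ordinal hi)).
  apply/allP => _ /mapP [i _ ->]; rewrite -rowpolyE addn1; exact: size_rowpoly.
(* With w = dim W and c = dim V.W the claim is b w <= c a, and it follows from |J| b w <= |I| a w <=
   |J| c a. *)
rewrite /fillratio ler_pdivlMr ?ltr0n // mulrAC ler_pdivrMr ?ltr0n //.
rewrite -!natrM ler_nat -(leq_pmul2l J0).
have db : (a + d = b)%N by rewrite subnKC // ltnW.
rewrite db in card_le.
move: (dimspan b ws) (dimspan b (prodspan _ _)) le card_le => w c le card_le.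
apply: (@leq_trans (#|I| * a * w)); first by rewrite mulnA leq_mul2r card_le orbT.
by rewrite mulnAC mulnA leq_mul2r le orbT.
Qed.
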